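(* Consider the special model $\mathrm{BOHT}(2,r,\lambda,D)$ with $\lambda\in[0,1]$ and $D$ a distribution on $\mathbb{Z}_{\ge0}$ with mean $d$. (i) If $r\in\{3,4\}$ and $(r-1)d\lambda^2\le 1$, reconstruction is impossible. (ii) If $r\ge 5$ and $(r-1)\,d\,\sup_{0<\epsilon\le 1}f_{r,\lambda}(\epsilon)<1$, where $f_{r,\lambda}(\epsilon):=\frac{1}{r-1}\sum_{i=1}^{r-1}\binom{r-1}{i}(1-\epsilon)^{r-1-i}\epsilon^{i-1}\frac{\lambda^2}{\lambda+(1-\lambda)2^{1-i}}$, then reconstruction is impossible. (iii) If $r\ge 5$, $\lambda\ge\frac15$ and $(r-1)d\lambda^2\le 1$, reconstruction is impossible.
   Context: For integer $r\ge2$ and $\lambda\in[0,1]$, $B_{r,\lambda}:\{\pm\}\to\{\pm\}^{r-1}$ is the kernel $B_{r,\lambda}(x_1,\dots,x_{r-1}|y)=\lambda+2^{-(r-1)}(1-\lambda)$ if $x_i=y$ for all $i$, and $2^{-(r-1)}(1-\lambda)$ otherwise. The special model $\mathrm{BOHT}(2,r,\lambda,D)$ is the broadcasting model on a Galton–Watson $r$-uniform linear hypertree rooted at $\rho$ in which each vertex independently has $t\sim D$ downward hyperedges (each consisting of the vertex and $r-1$ new children); $\sigma_\rho\sim\mathrm{Unif}(\{\pm\})$, and given $\sigma_u$, the labels of the $r-1$ children in each downward hyperedge of $u$ are drawn independently across hyperedges from $B_{r,\lambda}(\cdot|\sigma_u)$. With $T_k$ the set of vertices at distance $\le k$ from $\rho$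 and $L_k$ those at distance exactly $k$, reconstruction is impossible if $\lim_{k\to\infty}I(\sigma_\rho;T_k,\sigma_{L_k})=0$. *)

(* Defs.v *)
From HB Require Import structures.
From mathcomp Require Import all_boot all_order all_algebra.
From mathcomp Require Import all_classical all_reals all_analysis.
Set Implicit Arguments. Unset Strict Implicit. Unset Printing Implicit Defensive.
Import Order.TTheory GRing.Theory Num.Theory.
Import numFieldNormedType.Exports.
Local Open Scope classical_set_scope.
Local Open Scope ring_scope.

(* Labels {+,-} are encoded as bool (true = +). *)

Section BOHT.
Variable R : realType.

Definition is_distr (D : nat -> R) : Prop :=
  (forall n, 0 <= D n) /\ ((fun N => \sum_(n < N) D n) @ \oo --> (1 : R)).

Definition has_mean (D : nat -> R) (d : R) : Prop :=
  (fun N => \sum_(n < N) n%:R * D n) @ \oo --> d.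

Definition Bker (r : nat) (lam : R) (x : (r.-1).-tuple bool) (y : bool) : R :=
  (if all (fun xi => xi == y) x then lam else 0)
  + ((2 : R) ^+ r.-1)^-1 * (1 - lam).

(* Observations (T_k, sigma_{L_k}) are encoded as ordered trees in
   GenTree.tree bool (a countType):
   - a depth-0 vertex (i.e. a vertex of L_k) is  Leaf b, b its observed label;
   - a vertex at depth < k with t downward hyperedges is
       Node 0 [:: Node 0 e_1; ...; Node 0 e_t]
     where each e_j is the list of the r-1 subtrees of the children in the
     j-th downward hyperedge.
   [lik r lam D k s o] is the probability that the depth-k observation
   rooted at a vertex with label s equals o (0 for malformed codes). *)
Fixpoint lik (r : nat) (lam : R) (D : nat -> R) (k : nat) (s : bool)
    (o : GenTree.tree bool) {struct k} : R :=
  match k with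
  | 0 => if o is GenTree.Leaf b then (b == s)%:R else 0
  | k'.+1 =>
    match o with
    | GenTree.Node 0 hs =>
        D (size hs) *
        \prod_(h <- hs)
          match h with
          | GenTree.Node 0 cs =>
              if size cs == r.-1 then
                \sum_(x : (r.-1).-tuple bool)
                   Bker lam x s *
                   \prod_(i < r.-1) lik r lam D k' (tnth x i)
                                       (nth (GenTree.Leaf false) cs i)
              else 0
          | _ => 0
          end
    | _ => 0
    end
  end.

Definition plogp (p m : R) : R := if p == 0 then 0 else p * ln (p / m).

(* Contribution of observation o to I(sigma_rho; o), sigma_rho uniform:
   sum_s P(s) P(o|s) ln (P(o|s) / P(o)). *)
Definition mi_term (p q : R) : R :=
  let m := (p + q) / 2 in 2^-1 * (plogp p m + plogp q m).

Definition mutual_info (r : nat) (lam : R) (D : nat -> R) (k : nat) : \bar R :=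
  \esum_(o in [set: GenTree.tree bool])
     (mi_term (lik r lam D k true o) (lik r lam D k false o))%:E.

Definition reconstruction_impossible (r : nat) (lam : R) (D : nat -> R) : Prop :=
  mutual_info r lam D k @[k --> \oo] --> 0%E.

Definition fr (r : nat) (lam eps : R) : R :=
  (r.-1)%:R^-1 *
  \sum_(1 <= i < r)
    'C(r.-1, i)%:R * (1 - eps) ^+ (r.-1 - i) * eps ^+ i.-1 *
    (lam ^+ 2 / (lam + (1 - lam) * ((2 : R) ^+ i.-1)^-1)).

End BOHT.

(* Main.v *)
(* Let [p], [q] be the likelihoods of an observation under the root labels +, -;
   let [w = (p + q)/2] and [theta = (p - q)/(p + q)]. The mutual information is at
   most the chi-square information [E theta^2] and, by the symmetry under a global
   flip of the labels, [E theta^2] and [E (theta^2 + theta^4/3)] are subadditive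
   over conditionally independent hyperedges. So the information after one more
   generation is at most [d] times that carried by one hyperedge.
   The chi-square information carried by a hyperedge is, in each child, a convex
   function of [theta^2], hence at most its value when each child is revealed with
   probability [theta^2] and erased otherwise; averaging gives
   [(r-1) x f_{r,lambda}(x)] for children of information [x]. This settles (ii).
   When [j] revealed children carry information at most [j lambda^2], strictly so
   for [j >= 2], it also settles the Kesten-Stigum regime for [r = 3], for [r = 4]
   and [lambda >= 1/8], and for [lambda >= 1/5]: a gain [kappa x^2] makes the
   information decay like [1/k]. For [r = 4] and [lambda <= 1/8], the functional
   [theta^2 + theta^4/3] is used instead, with a gain coming from [E theta^4].
   Infinite sums over trees are replaced by sums over finite sets of trees closed
   under the flip, on which the likelihoods have total mass at most 1. *)

Require Import Defs.
From HB Require Import structures.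
From mathcomp Require Import all_boot all_order all_algebra.
From mathcomp Require Import all_classical all_reals all_analysis.
From mathcomp Require Import ring lra.
Import Order.TTheory GRing.Theory Num.Theory.
Import numFieldNormedType.Exports.
Local Open Scope classical_set_scope.
Local Open Scope ring_scope.
Set Implicit Arguments. Unset Strict Implicit. Unset Printing Implicit Defensive.

(** * Pointwise inequalities for the information of one or two observations *)

Section RealInequalities.
Variable R : realFieldType.
Implicit Types (a b c lam p q t u w x y : R).

(* The contribution [w * (theta^2 + c * theta^4)] of an observation to
   [E (theta^2 + c theta^4)]; it is [0] when [p = q = 0]. *)
Definition phi c p q : R :=
  let w := (p + q) / 2 in let dl := (p - q) / 2 in dl ^+ 2 / w + c * (dl ^+ 4 / w ^+ 3).

(** This is [phi] in terms of the mean [w] and the half-difference [x]. It is homogeneous of degree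
    one, which allows normalising to [w = 1]. *)
Definition gfun c w x : R := x ^+ 2 / w + c * (x ^+ 4 / w ^+ 3).

Ltac nneg := repeat (first [assumption | exact: sqr_ge0 | exact: ltW | lra
  | apply: exprn_ge0 | apply: mulr_ge0 | rewrite invr_ge0 ]).

Lemma expr4 x : x ^+ 4 = (x ^+ 2) ^+ 2.
Proof. by rewrite -exprM. Qed.

Lemma phiE c p q : phi c p q = gfun c ((p + q) / 2) ((p - q) / 2).
Proof. by []. Qed.

Lemma gfunZ c k w x : gfun c (k * w) (k * x) = k * gfun c w x.
Proof.
rewrite /gfun; have [->|k0] := eqVneq k 0; first by rewrite !mul0r !expr0n /= !mul0r mulr0 addr0.
have [->|w0] := eqVneq w 0; first by rewrite mulr0 !expr0n /= !invr0 !mulr0 addr0 mulr0.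
by field; rewrite k0 w0.
Qed.

Lemma gfunN c w x : gfun c w (- x) = gfun c w x.
Proof. by rewrite /gfun !expr4 sqrrN. Qed.

Lemma gfun_ge0 c w x : 0 <= c -> 0 <= w -> 0 <= gfun c w x.
Proof.
move=> c0 w0; rewrite /gfun expr4; apply: addr_ge0; first by rewrite divr_ge0 ?sqr_ge0.
by rewrite mulr_ge0 // divr_ge0 ?sqr_ge0 // exprn_ge0.
Qed.

(** Affinity in [c] reduces subadditivity for [0 <= c <= 3^-1] to the two endpoints. *)
Lemma gfun_affine c w x :
  gfun c w x = (1 - 3 * c) * gfun 0 w x + 3 * c * gfun 3^-1 w x.
Proof. by rewrite /gfun; move: (_ / w) (_ / w ^+ 3) => A B; field. Qed.

(** Independent observations of biases [t1] and [t2] combine to mean [1 + t1 * t2] and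
    half-difference [t1 + t2]; the second term has [t2] flipped. The gap is an explicit nonnegative
    fraction. *)
Lemma subadd_sq t1 t2 : -1 <= t1 <= 1 -> -1 <= t2 <= 1 ->
  (gfun 0 (1 + t1 * t2) (t1 + t2) + gfun 0 (1 - t1 * t2) (t1 - t2)) / 2
   <= gfun 0 1 t1 + gfun 0 1 t2.
Proof.
move=> h1 h2; rewrite /gfun !mul0r !addr0 !divr1.
have ha : 0 <= t1 ^+ 2 <= 1 by nra.
have hb : 0 <= t2 ^+ 2 <= 1 by nra.
have hp : -1 <= t1 * t2 <= 1 by nra.
(* Division by zero gives [0], so the boundary cases escape the common-denominator identity and are
   checked directly. *)
have [e|n1] := eqVneq (1 + t1 * t2) 0.
  have -> : t1 + t2 = 0 by nra.
  have -> : 1 - t1 * t2 = 2 by lra.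
  nra.
have [e|n2] := eqVneq (1 - t1 * t2) 0.
  have -> : t1 - t2 = 0 by nra.
  have -> : 1 + t1 * t2 = 2 by lra.
  nra.
have q1 : 0 < 1 + t1 * t2 by rewrite lt_def n1; lra.
have q2 : 0 < 1 - t1 * t2 by rewrite lt_def n2; lra.
rewrite -subr_ge0.
have -> : t1 ^+ 2 + t2 ^+ 2 - ((t1 + t2) ^+ 2 / (1 + t1 * t2) + (t1 - t2) ^+ 2 / (1 - t1 * t2)) / 2
  = (t1 * t2) ^+ 2 * (2 - t1 ^+ 2 - t2 ^+ 2) / ((1 + t1 * t2) * (1 - t1 * t2)).
  by field; rewrite n1 n2.
by nneg.
Qed.

(* Used with [t = |t1 t2|] and [S = t1^2 + t2^2]. A convex quadratic in [S], equal to
   [- 2 t (1-t)^3 (3+t)^2] and [- (1-t^2)^3 (3+t^2)] at the endpoints of its range. *)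
Lemma subadd_quadratic_form t S : 0 <= t < 1 -> 2 * t <= S <= 1 + t ^+ 2 ->
  S ^+ 2 * (6 - 3 * t ^+ 2 + t ^+ 4) - S * (9 + 10 * t ^+ 2 - 3 * t ^+ 4)
   + 18 * t ^+ 2 - 2 * t ^+ 6 <= 0.
Proof.
move=> ht hS; set Q := (X in X <= 0).
have h1 : 0 < (1 - t) ^+ 2 by rewrite exprn_gt0 //; lra.
rewrite -(pmulr_rle0 _ h1).
have -> : (1 - t) ^+ 2 * Q =
  - ((1 - t) ^+ 2 * (6 - 3 * t ^+ 2 + t ^+ 4) * ((S - 2 * t) * (1 + t ^+ 2 - S)))
  - ((1 - t ^+ 2) ^+ 3 * (3 + t ^+ 2) * (S - 2 * t))
  - (2 * t * (1 - t) ^+ 3 * (3 + t) ^+ 2 * (1 + t ^+ 2 - S)).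
  by rewrite /Q; ring.
have t2 : 0 <= t ^+ 2 <= 1 by nra.
have t4 : 0 <= t ^+ 4 by rewrite exprn_ge0 //; lra.
have g1 : 0 <= (1 - t) ^+ 2 * (6 - 3 * t ^+ 2 + t ^+ 4) * ((S - 2 * t) * (1 + t ^+ 2 - S)).
  by nneg.
have g2 : 0 <= (1 - t ^+ 2) ^+ 3 * (3 + t ^+ 2) * (S - 2 * t).
  by nneg.
have g3 : 0 <= 2 * t * (1 - t) ^+ 3 * (3 + t) ^+ 2 * (1 + t ^+ 2 - S).
  by nneg.
lra.
Qed.

Lemma subadd_quartic t1 t2 : -1 <= t1 <= 1 -> -1 <= t2 <= 1 ->
  (gfun 3^-1 (1 + t1 * t2) (t1 + t2) + gfun 3^-1 (1 - t1 * t2) (t1 - t2)) / 2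
   <= gfun 3^-1 1 t1 + gfun 3^-1 1 t2.
Proof.
(* Flipping [t2] exchanges the two terms; afterwards only [1 - t1 * t2] can vanish. *)
wlog h : t2 / 0 <= t1 * t2 => [W h1 h2|h1 h2].
  have [/W->//|h] := leP 0 (t1 * t2).
  have := W (- t2); rewrite mulrN !opprK (gfunN _ _ t2) [_ + gfun _ _ (t1 + t2)]addrC.
  by apply=> //; lra.
rewrite /gfun !expr1n !divr1.
have ha : 0 <= t1 ^+ 2 <= 1 by nra.
have hb : 0 <= t2 ^+ 2 <= 1 by nra.
have hp : -1 <= t1 * t2 <= 1 by nra.
have [e|n2] := eqVneq (1 - t1 * t2) 0.
  have e12 : t1 = t2 by nra.
  have -> : t1 - t2 = 0 by lra.
  have -> : 1 + t1 * t2 = 2 by lra.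
  have e2 : t2 ^+ 2 = 1 by nra.
  have e4 : t2 ^+ 4 = 1 by rewrite expr4 e2 expr1n.
  rewrite e12 e2 e4 -mulr2n !exprMn_n e2 e4 !expr0n /=.
  by lra.
have q1 : 0 < 1 + t1 * t2 by lra.
have q2 : 0 < 1 - t1 * t2 by rewrite lt_def n2; lra.
have n1 : 1 + t1 * t2 != 0 by rewrite gt_eqF.
rewrite -subr_ge0.
set S := t1 ^+ 2 + t2 ^+ 2; set t := t1 * t2.
(* Over the common denominator the gap is minus the quadratic form in [S]. The range of [S] comes
   from [(t1 - t2) ^+ 2 >= 0] and [(1 - t1 ^+ 2) * (1 - t2 ^+ 2) >= 0]. *)
have -> : t1 ^+ 2 + 3^-1 * t1 ^+ 4 + (t2 ^+ 2 + 3^-1 * t2 ^+ 4) -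
  ((t1 + t2) ^+ 2 / (1 + t1 * t2) + 3^-1 * ((t1 + t2) ^+ 4 / (1 + t1 * t2) ^+ 3) +
   ((t1 - t2) ^+ 2 / (1 - t1 * t2) + 3^-1 * ((t1 - t2) ^+ 4 / (1 - t1 * t2) ^+ 3))) / 2
  = t ^+ 2 * (- (S ^+ 2 * (6 - 3 * t ^+ 2 + t ^+ 4) - S * (9 + 10 * t ^+ 2 - 3 * t ^+ 4)
   + 18 * t ^+ 2 - 2 * t ^+ 6)) / (3 * ((1 + t) * (1 - t)) ^+ 3).
  by rewrite /S /t; field; rewrite n1 n2.
apply: divr_ge0; last by nneg.
apply: mulr_ge0; first exact: sqr_ge0.
rewrite oppr_ge0 subadd_quadratic_form /S /t //; first by lra.
have h3 : 0 <= (1 - t1 ^+ 2) * (1 - t2 ^+ 2) by nneg.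
have h4 : 0 <= (t1 - t2) ^+ 2 by exact: sqr_ge0.
by lra.
Qed.

Lemma subadd_unit c t1 t2 : 0 <= c <= 3^-1 -> -1 <= t1 <= 1 -> -1 <= t2 <= 1 ->
  (gfun c (1 + t1 * t2) (t1 + t2) + gfun c (1 - t1 * t2) (t1 - t2)) / 2
   <= gfun c 1 t1 + gfun c 1 t2.
Proof.
move=> hc h1 h2.
have i0 := subadd_sq h1 h2; have i3 := subadd_quartic h1 h2.
rewrite !(@gfun_affine c).
have c1 : 0 <= 1 - 3 * c by lra.
have c2 : 0 <= 3 * c by lra.
have := lerD (ler_wpM2l c1 i0) (ler_wpM2l c2 i3).
lra.
Qed.

(** Polar coordinates of a pair of likelihoods: mass [w] and bias [t], with [t = 0] chosen on null
    observations. *)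
Lemma ratio_bound p q : 0 <= p -> 0 <= q ->
  exists w t, [/\ 0 <= w, -1 <= t <= 1, p = w * (1 + t) & q = w * (1 - t)].
Proof.
move=> p0 q0; have [e|n] := eqVneq (p + q) 0.
  by exists 0, 0; rewrite !mul0r; split; lra.
exists ((p + q) / 2), ((p - q) / (p + q)).
have s0 : 0 < p + q by rewrite lt_def n addr_ge0.
split; [lra| |by field|by field].
by rewrite ler_pdivlMr // ler_pdivrMr //; lra.
Qed.

Lemma phi_polar c w t : phi c (w * (1 + t)) (w * (1 - t)) = w * gfun c 1 t.
Proof. by rewrite phiE -gfunZ; congr (gfun c _ _); field. Qed.

Lemma phi_subadd c p1 q1 p2 q2 : 0 <= c <= 3^-1 ->
  0 <= p1 -> 0 <= q1 -> 0 <= p2 -> 0 <= q2 ->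
  (phi c (p1 * p2) (q1 * q2) + phi c (q1 * p2) (p1 * q2)) / 2
  <= (p2 + q2) / 2 * phi c p1 q1 + (p1 + q1) / 2 * phi c p2 q2.
Proof.
move=> hc /ratio_bound H /H{H}[w1 [t1 [w10 h1 -> ->]]].
move=> /ratio_bound H /H{H}[w2 [t2 [w20 h2 -> ->]]].
rewrite !phi_polar !phiE.
have -> : (w1 * (1 + t1) * (w2 * (1 + t2)) + w1 * (1 - t1) * (w2 * (1 - t2))) / 2
  = w1 * w2 * (1 + t1 * t2) by field.
have -> : (w1 * (1 + t1) * (w2 * (1 + t2)) - w1 * (1 - t1) * (w2 * (1 - t2))) / 2
  = w1 * w2 * (t1 + t2) by field.
have -> : (w1 * (1 - t1) * (w2 * (1 + t2)) + w1 * (1 + t1) * (w2 * (1 - t2))) / 2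
  = w1 * w2 * (1 - t1 * t2) by field.
have -> : (w1 * (1 - t1) * (w2 * (1 + t2)) - w1 * (1 + t1) * (w2 * (1 - t2))) / 2
  = w1 * w2 * (- (t1 - t2)) by field.
rewrite !gfunZ gfunN.
have := ler_wpM2l (mulr_ge0 w10 w20) (subadd_unit hc h1 h2).
lra.
Qed.

Lemma phi_ge0 c p q : 0 <= c -> 0 <= p -> 0 <= q -> 0 <= phi c p q.
Proof. by move=> *; rewrite phiE gfun_ge0 // divr_ge0 ?addr_ge0. Qed.

Lemma phiZ c k p q : phi c (k * p) (k * q) = k * phi c p q.
Proof. by rewrite !phiE -gfunZ; congr gfun; ring. Qed.

Lemma phi_ub c p q : 0 <= c -> 0 <= p -> 0 <= q -> phi c p q <= (1 + c) * ((p + q) / 2).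
Proof.
move=> c0 /ratio_bound H /H{H}[w [t [w0 ht -> ->]]].
rewrite phi_polar /gfun !expr1n !divr1.
have -> : (w * (1 + t) + w * (1 - t)) / 2 = w by field.
rewrite mulrC ler_wpM2r // lerD //; first by nra.
rewrite -[leRHS]mulr1 ler_wpM2l // expr4 exprn_ile1 ?sqr_ge0 //; nra.
Qed.

(* With [u = t^2], the symmetrised sum is a Moebius function of [u] that is convex on
   [0, 1], so it lies below its chord. *)
Lemma chord_unit a b c e t : -1 <= t <= 1 -> `|e - a| <= c - b -> `|e + a| <= c + b ->
  (((e + t * a) ^+ 2 / (c + t * b)) + (e - t * a) ^+ 2 / (c - t * b)) / 2
  <= (1 - t ^+ 2) * (e ^+ 2 / c)
     + t ^+ 2 * (((e + a) ^+ 2 / (c + b) + (e - a) ^+ 2 / (c - b)) / 2).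
Proof.
move=> ht hm hp.
have hm0 := le_trans (normr_ge0 _) hm; have hp0 := le_trans (normr_ge0 _) hp.
(* Here [hm] forces [e = a], so numerator and denominator vanish together; [c = 0], [t = 1] and
   [t = -1] bring further zero denominators. The case [c + b = 0] is the mirror image. *)
have [e1|n1] := eqVneq (c - b) 0.
  have hea : e - a = 0 by apply/normr0_eq0/le_anti; rewrite normr_ge0 -e1 hm.
  have -> : a = e by lra.
  have -> : b = c by lra.
  have [->|nc] := eqVneq c 0; first by rewrite !mulr0 !(add0r, subr0, oppr0) !invr0 !mulr0; lra.
  have [->|nt1] := eqVneq t 1; first by rewrite !mul1r !subrr !expr0n /= !mul0r !expr1n; lra.
  have [->|nt2] := eqVneq t (-1).
    by rewrite !mulN1r !opprK !subrr !expr0n /= !mul0r sqrrN expr1n; lra.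
  have m1 : c - t * c != 0 by rewrite -{1}[c]mul1r -mulrBl mulf_neq0 // subr_eq0 eq_sym.
  have m2 : c + t * c != 0 by rewrite -{1}[c]mul1r -mulrDl mulf_neq0 // addrC addr_eq0.
  rewrite !(subrr, addNr, addrN) expr0n /= !mul0r le_eqVlt; apply/orP; left; apply/eqP; field.
  by rewrite ?mulrN ?opprK ?m1 ?m2 -?mulr2n ?mulrn_eq0 ?nc.
have [e1|n2] := eqVneq (c + b) 0.
  have hea : e + a = 0 by apply/normr0_eq0/le_anti; rewrite normr_ge0 -e1 hp.
  have -> : a = - e by lra.
  have -> : b = - c by lra.
  have [->|nc] := eqVneq c 0; first by rewrite ?oppr0 !mulr0 !(add0r, subr0, oppr0) !invr0 !mulr0; lra.
  have [->|nt1] := eqVneq t 1; first by rewrite !mul1r !subrr !expr0n /= !mul0r !expr1n; lra.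
  have [->|nt2] := eqVneq t (-1).
    by rewrite !mulN1r !opprK !subrr !expr0n /= !mul0r sqrrN expr1n; lra.
  have m1 : c - t * c != 0 by rewrite -{1}[c]mul1r -mulrBl mulf_neq0 // subr_eq0 eq_sym.
  have m2 : c + t * c != 0 by rewrite -{1}[c]mul1r -mulrDl mulf_neq0 // addrC addr_eq0.
  rewrite !(subrr, addNr, addrN) expr0n /= !mul0r le_eqVlt; apply/orP; left; apply/eqP; field.
  by rewrite ?mulrN ?opprK ?m1 ?m2 -?mulr2n ?mulrn_eq0 ?nc.
have cb1 : 0 < c - b by rewrite lt_def n1.
have cb2 : 0 < c + b by rewrite lt_def n2.
have c0 : 0 < c by lra.
have tb : `|t * b| < c.
  rewrite normrM; apply: (@le_lt_trans _ _ `|b|); last by rewrite ltr_norml; lra.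
  by rewrite ler_piMl // ler_norml.
have [ct1 ct2] : 0 < c + t * b /\ 0 < c - t * b by move: tb; rewrite ltr_norml; lra.
have t2 : 0 <= t ^+ 2 <= 1 by nra.
rewrite -subr_ge0.
have -> : (1 - t ^+ 2) * (e ^+ 2 / c)
     + t ^+ 2 * (((e + a) ^+ 2 / (c + b) + (e - a) ^+ 2 / (c - b)) / 2) -
  (((e + t * a) ^+ 2 / (c + t * b)) + (e - t * a) ^+ 2 / (c - t * b)) / 2
  = t ^+ 2 * (1 - t ^+ 2) * (b * (c * a - e * b)) ^+ 2
   / (c * (c + b) * (c - b) * (c + t * b) * (c - t * b)).
  by field; rewrite !gt_eqF.
by nneg.
Qed.

End RealInequalities.

(** * Words over a finite alphabet, for the children of a hyperedge and the hyperedges of a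
    vertex *)

Fixpoint words (T : Type) (n : nat) (A : seq T) : seq (seq T) :=
  if n is n'.+1 then [seq x :: s | x <- A, s <- words n' A] else [:: [::]].

Lemma mem_words (T : eqType) n (A : seq T) s :
  (s \in words n A) = (size s == n) && all (mem A) s.
Proof.
elim: n s => [|n IH] s; first by rewrite inE; case: s.
apply/allpairsP/idP => [[[x t] /= [xA tW ->]]|].
  by move: tW; rewrite /= xA IH eqSS.
case: s => //= x t /andP[st /andP[xA tA]].
by exists (x, t); rewrite IH -eqSS st tA.
Qed.

Section WordSums.
Variables (R : realFieldType) (T : Type).
Implicit Types (A : seq T) (n : nat).

Lemma sum_wordsS n A (F : seq T -> R) :
  \sum_(s <- words n.+1 A) F s = \sum_(x <- A) \sum_(s <- words n A) F (x :: s).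
Proof. by rewrite big_allpairs_dep. Qed.

Lemma sum_words_prod n A (f : T -> R) :
  \sum_(s <- words n A) \prod_(x <- s) f x = (\sum_(x <- A) f x) ^+ n.
Proof.
elim: n => [|n IH]; first by rewrite big_seq1 big_nil expr0.
rewrite sum_wordsS exprS -IH mulr_suml; apply: eq_bigr => x _.
by rewrite mulr_sumr; apply: eq_bigr => s _; rewrite big_cons.
Qed.

End WordSums.

(** * Binomial averages *)

Section BinomialAverage.
Variable R : realFieldType.
Implicit Types (X a b c : R) (n j : nat) (g : nat -> R).

(** The expectation of [g J] for [J] binomial with parameters [n] and [X]. *)
Definition binavg X n g := \sum_(j < n.+1) 'C(n, j)%:R * X ^+ j * (1 - X) ^+ (n - j) * g j.

Lemma binavg0 X g : binavg X 0 g = g 0%N.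
Proof. by rewrite /binavg big_ord1 bin0 subnn !expr0 !mul1r. Qed.

(** Condition on one Bernoulli trial; combinatorially this is Pascal's rule. *)
Lemma binavgS X n g : binavg X n.+1 g = binavg X n (fun j => (1 - X) * g j + X * g j.+1).
Proof.
rewrite /binavg big_ord_recl /= bin0 subn0.
under eq_bigr => i _ do rewrite /bump /= add1n binS subSS natrD !mulrDl.
rewrite big_split /= addrA.
under [RHS]eq_bigr => i _ do rewrite mulrDr.
rewrite big_split /=; congr (_ + _); last first.
  by apply: eq_bigr => i _; rewrite exprS; move: ('C(n, i)%:R : R) ((1 - X) ^+ (n - i)) => u v; ring.
rewrite [RHS]big_ord_recl bin0 subn0 big_ord_recr /= bin_small // !mul0r addr0.
congr (_ + _); first by rewrite !expr0 exprS; ring.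
apply: eq_bigr => i _; rewrite /bump /= add1n.
rewrite -(subnSK (ltn_ord i)) [(1 - X) ^+ _.+1]exprS.
by move: ('C(n, i.+1)%:R : R) ((1 - X) ^+ (n - i.+1)) (X ^+ i.+1) => u v z; ring.
Qed.

Lemma eq_binavg X n g g' : g =1 g' -> binavg X n g = binavg X n g'.
Proof. by move=> gg; apply: eq_bigr => j _; rewrite gg. Qed.

Lemma ler_binavg X n g g' : 0 <= X <= 1 -> (forall j, (j <= n)%N -> g j <= g' j) ->
  binavg X n g <= binavg X n g'.
Proof.
move=> /andP[X0 X1] gg; apply: ler_sum => j _.
apply: ler_wpM2l; last by apply: gg; rewrite -ltnS.
by rewrite !mulr_ge0 ?exprn_ge0 ?subr_ge0 ?ler0n.
Qed.

(** These are the first two factorial moments of the binomial law. Quadratics in [j] are stable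
    under conditioning on one trial, so the induction closes. *)
Lemma binavg_quad X n a b c :
  binavg X n (fun j => a + b * j%:R + c * (j%:R * (j%:R - 1)))
  = a + b * (n%:R * X) + c * (n%:R * (n%:R - 1) * X ^+ 2).
Proof.
elim: n a b c => [|n IH] a b c; first by rewrite binavg0; ring.
rewrite binavgS -natr1.
rewrite (@eq_binavg _ _ _ (fun j => (a + X * b) + (b + 2 * X * c) * j%:R + c * (j%:R * (j%:R - 1)))).
  by rewrite IH; ring.
by move=> j; rewrite -natr1; ring.
Qed.

Lemma binavg_sum X n (T : Type) (A : seq T) (g : T -> nat -> R) :
  \sum_(x <- A) binavg X n (g x) = binavg X n (fun j => \sum_(x <- A) g x j).
Proof. by rewrite exchange_big; apply: eq_bigr => j _; rewrite mulr_sumr. Qed.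

End BinomialAverage.

(** * Symmetric binary channels: subadditivity and comparison with erasures *)

Section Channels.
Variables (R : realFieldType) (T : Type) (A : seq T) (p q : T -> R).
Hypotheses (p0 : forall x, 0 <= p x) (q0 : forall x, 0 <= q x).
Hypothesis sym : forall F : R -> R -> R,
  \sum_(x <- A) F (p x) (q x) = \sum_(x <- A) F (q x) (p x).
Hypothesis mass : \sum_(x <- A) (p x + q x) / 2 <= 1.

Let w x := (p x + q x) / 2.
Let w0 x : 0 <= w x. Proof. by rewrite divr_ge0 // addr_ge0. Qed.
Let prod_ge0 (f : T -> R) (f0 : forall x, 0 <= f x) (s : seq T) : 0 <= \prod_(x <- s) f x.
Proof. by rewrite prodr_ge0. Qed.

Lemma sum_symm (F : R -> R -> R) :
  \sum_(x <- A) F (p x) (q x) = \sum_(x <- A) (F (p x) (q x) + F (q x) (p x)) / 2.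
Proof. by rewrite -mulr_suml big_split /= -sym; field. Qed.

(** Flip the first letter with [sym], then the rest of the word by induction; the product of the
    weights is unchanged by flips and rides along as a third argument. *)
Lemma words_sym n (F : R -> R -> R -> R) :
  \sum_(s <- words n A) F (\prod_(x <- s) p x) (\prod_(x <- s) q x) (\prod_(x <- s) w x)
  = \sum_(s <- words n A) F (\prod_(x <- s) q x) (\prod_(x <- s) p x) (\prod_(x <- s) w x).
Proof.
elim: n F => [|n IH] F; first by rewrite !big_seq1 !big_nil.
rewrite !sum_wordsS.
(* The weight of the first letter is written [(a + b) / 2] so that [G] depends only on its two
   likelihoods, as [sym] requires. *)
pose G a b := \sum_(s <- words n A) F (a * \prod_(x <- s) p x) (b * \prod_(x <- s) q x) ((a + b) / 2 * \prod_(x <- s) w x).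
transitivity (\sum_(x <- A) G (q x) (p x)).
  by rewrite -sym; apply: eq_bigr => x _; apply: eq_bigr => s _; rewrite !big_cons.
apply: eq_bigr => x _; apply: etrans (IH (fun a b c => F (q x * a) (p x * b) ((q x + p x) / 2 * c))) _.
by apply: eq_bigr => s _; rewrite !big_cons [q x + p x]addrC.
Qed.

(** Flipping only the first letter produces the two-term average of [phi_subadd]. The masses left as
    factors are at most 1, so each letter costs one copy of the single-letter sum. *)
Lemma phi_sum_words_le c n : 0 <= c <= 3^-1 ->
  \sum_(s <- words n A) phi c (\prod_(x <- s) p x) (\prod_(x <- s) q x)
  <= n%:R * \sum_(x <- A) phi c (p x) (q x).
Proof.
move=> hc; have c0 : 0 <= c by lra.
set Y := \sum_(x <- A) _.
have Y0 : 0 <= Y by apply: sumr_ge0 => x _; rewrite phi_ge0.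
elim: n => [|n IH].
  by rewrite big_seq1 !big_nil mul0r /phi subrr mul0r !expr0n /= !mul0r mulr0 addr0.
pose P s := \prod_(x <- s) p x; pose Q s := \prod_(x <- s) q x.
pose F s a b := phi c (a * P s) (b * Q s).
rewrite sum_wordsS exchange_big /=.
apply: (@le_trans _ _ (\sum_(s <- words n A) \sum_(x <- A)
    ((P s + Q s) / 2 * phi c (p x) (q x) + w x * phi c (P s) (Q s)))).
  apply: ler_sum => s _.
  under eq_bigr => x _ do rewrite !big_cons -/(P s) -/(Q s) -/(F s (p x) (q x)).
  rewrite (sum_symm (F s)); apply: ler_sum => x _.
  by apply: phi_subadd => //; apply: prod_ge0.
under eq_bigr => s _ do rewrite big_split /= -mulr_sumr -mulr_suml -/Y.
rewrite big_split /= [leRHS](_ : _ = Y + n%:R * Y); last by rewrite -natr1; ring.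
have mp : \sum_(x <- A) p x <= 1.
  by move: mass; rewrite -mulr_suml big_split /= (sym (fun a b => b)) /=; lra.
have mq : \sum_(x <- A) q x <= 1 by rewrite (sym (fun a b => b)).
apply: lerD; last first.
  apply: le_trans IH; rewrite -mulr_sumr; rewrite -[leRHS]mul1r ler_wpM2r // sumr_ge0 // => s _.
  by rewrite phi_ge0 // prod_ge0.
rewrite -mulr_suml -[leRHS]mul1r ler_wpM2r // -mulr_suml big_split /= !sum_words_prod.
have := @exprn_ile1 R n (\sum_(x <- A) p x); have := @exprn_ile1 R n (\sum_(x <- A) q x).
have sp0 : 0 <= \sum_(x <- A) p x by rewrite sumr_ge0.
have sq0 : 0 <= \sum_(x <- A) q x by rewrite sumr_ge0.
move=> /(_ sq0 mq) h1 /(_ sp0 mp) h2; lra.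
Qed.

Variable lam : R.
Hypothesis lam01 : 0 <= lam <= 1.

(** Here [a] and [b] are the likelihoods of the children when all copy a parent label + or -, and
    [e] is their likelihood under independent uniform labels; [lam] mixes the two. *)
Definition edge_phi c (a b e : R) := phi c (lam * a + (1 - lam) * e) (lam * b + (1 - lam) * e).

Lemma edge_phi_ge0 c a b e : 0 <= c -> 0 <= a -> 0 <= b -> 0 <= e -> 0 <= edge_phi c a b e.
Proof.
by move=> c0 a0 b0 e0; apply: phi_ge0 => //; apply: addr_ge0; apply: mulr_ge0 => //; move: lam01; lra.
Qed.

Lemma edge_phiZ c k a b e : edge_phi c (k * a) (k * b) (k * e) = k * edge_phi c a b e.
Proof. by rewrite -phiZ; congr phi; ring. Qed.

Lemma edge_phi0E a b e :
  edge_phi 0 a b e = (lam * (a - b) / 2) ^+ 2 / (lam * (a + b) / 2 + (1 - lam) * e).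
Proof. by rewrite /edge_phi /phi mul0r addr0; congr (_ ^+ 2 / _); field. Qed.

(** By [chord_unit], a child of mass [v] and bias [t] may be replaced by one revealed with weight
    [v * t ^+ 2 = phi 0 x y] and erased otherwise. A revealed sign keeps only one of [a], [b] and
    halves [e]. *)
Lemma chord_step a b e x y : 0 <= a -> 0 <= b -> 0 <= e -> 0 <= x -> 0 <= y ->
  (edge_phi 0 (a * x) (b * y) (e * ((x + y) / 2)) + edge_phi 0 (a * y) (b * x) (e * ((y + x) / 2))) / 2
  <= ((x + y) / 2 - phi 0 x y) * edge_phi 0 a b e
     + phi 0 x y * (edge_phi 0 a 0 (e / 2) + edge_phi 0 0 b (e / 2)).
Proof.
move=> a0 b0 e0 /ratio_bound H /H{H}[v [t [v0 ht -> ->]]].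
have [l0 l1] : 0 <= lam /\ 0 <= 1 - lam by move: lam01; lra.
have le0 := mulr_ge0 l1 e0.
rewrite phi_polar.
have -> : (v * (1 + t) + v * (1 - t)) / 2 = v by field.
have -> : (v * (1 - t) + v * (1 + t)) / 2 = v by field.
have -> : gfun 0 1 t = t ^+ 2 by rewrite /gfun mul0r addr0 divr1.
rewrite [e * v]mulrC !(mulrCA _ v) !edge_phiZ.
suff H : (edge_phi 0 (a * (1 + t)) (b * (1 - t)) e + edge_phi 0 (a * (1 - t)) (b * (1 + t)) e) / 2
  <= (1 - t ^+ 2) * edge_phi 0 a b e + t ^+ 2 * (edge_phi 0 a 0 (e / 2) + edge_phi 0 0 b (e / 2)).
  by have := ler_wpM2l v0 H; lra.
have m1 : `|lam * (a - b) / 2 - lam * (a + b) / 2|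
   <= (lam * (a + b) / 2 + (1 - lam) * e) - lam * (a - b) / 2.
  have -> : lam * (a - b) / 2 - lam * (a + b) / 2 = - (lam * b) by field.
  by rewrite normrN ger0_norm ?mulr_ge0 //; lra.
have m2 : `|lam * (a - b) / 2 + lam * (a + b) / 2|
   <= (lam * (a + b) / 2 + (1 - lam) * e) + lam * (a - b) / 2.
  have -> : lam * (a - b) / 2 + lam * (a + b) / 2 = lam * a by field.
  by rewrite ger0_norm ?mulr_ge0 //; lra.
have := chord_unit ht m1 m2; rewrite !edge_phi0E.
have half z y0 : z ^+ 2 / y0 / 2 = (z / 2) ^+ 2 / (y0 / 2) :> R.
  have [->|yn] := eqVneq y0 0; first by rewrite !mul0r !invr0 !mulr0 mul0r.
  by field.
rewrite [X in t ^+ 2 * X]mulrDl !half.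
have le_eq (x1 y1 x2 y2 : R) : x1 = y1 -> x2 = y2 -> x1 <= x2 -> y1 <= y2 by move=> -> ->.
apply: le_eq.
  by congr ((_ + _) / 2); congr (_ ^+ 2 / _); field.
by congr (_ + _ * (_ + _)); congr (_ ^+ 2 / _); field.
Qed.

(* The information once [j] children have been revealed exactly: only the two patterns
   in which they all agree are informative. *)
Definition revealed (a b e : R) (j : nat) : R :=
  if j is 0 then edge_phi 0 a b e
  else edge_phi 0 a 0 (e / 2 ^+ j) + edge_phi 0 0 b (e / 2 ^+ j).

Let X := \sum_(x <- A) phi 0 (p x) (q x).

Lemma X01 : 0 <= X <= 1.
Proof.
rewrite sumr_ge0 => [|x _]; last by rewrite phi_ge0.
apply: le_trans mass; apply: ler_sum => x _.
by apply: le_trans (phi_ub _ _ _) _ => //; rewrite addr0 mul1r.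
Qed.

Lemma chord_sum a b e : 0 <= a -> 0 <= b -> 0 <= e ->
  \sum_(x <- A) edge_phi 0 (a * p x) (b * q x) (e * w x)
  <= (1 - X) * edge_phi 0 a b e + X * (edge_phi 0 a 0 (e / 2) + edge_phi 0 0 b (e / 2)).
Proof.
move=> a0 b0 e0.
rewrite (sum_symm (fun u v => edge_phi 0 (a * u) (b * v) (e * ((u + v) / 2)))).
apply: (@le_trans _ _ (\sum_(x <- A) ((w x - phi 0 (p x) (q x)) * edge_phi 0 a b e
   + phi 0 (p x) (q x) * (edge_phi 0 a 0 (e / 2) + edge_phi 0 0 b (e / 2))))).
  by apply: ler_sum => x _; apply: chord_step.
rewrite big_split /= -!mulr_suml -/X lerD2r ler_wpM2r ?edge_phi_ge0 //.
by rewrite sumrB lerD2r.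
Qed.

(** For [j > 0] the two unanimous patterns [(a, 0)] and [(0, b)] evolve separately under
    [chord_sum], and a contradictory reveal contributes zero. *)
Lemma revealed_step a b e j : 0 <= a -> 0 <= b -> 0 <= e ->
  \sum_(x <- A) revealed (a * p x) (b * q x) (e * w x) j
  <= (1 - X) * revealed a b e j + X * revealed a b e j.+1.
Proof.
move=> a0 b0 e0; case: j => [|j]; rewrite /revealed; first by rewrite expr1; apply: chord_sum.
have e20 : 0 <= e / 2 ^+ j.+1 by rewrite divr_ge0 // exprn_ge0.
have z0 z : edge_phi 0 0 0 z = 0 by rewrite edge_phi0E subrr mulr0 mul0r expr0n /= mul0r.
have := lerD (chord_sum a0 (lexx 0) e20) (chord_sum (lexx 0) b0 e20).
rewrite -big_split /= !z0 !addr0 !add0r.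
have -> : e / 2 ^+ j.+1 / 2 = e / 2 ^+ j.+2 by rewrite -mulrA -invfM -exprSr.
under eq_bigr => x _ do rewrite !mul0r ![e / _ * w x]mulrAC.
lra.
Qed.

(** Replacing the children one at a time amounts to [n] Bernoulli trials of parameter [X]. *)
Lemma edge_chord n a b e : 0 <= a -> 0 <= b -> 0 <= e ->
  \sum_(s <- words n A)
     edge_phi 0 (a * \prod_(x <- s) p x) (b * \prod_(x <- s) q x) (e * \prod_(x <- s) w x)
  <= binavg X n (revealed a b e).
Proof.
elim: n a b e => [|n IH] a b e a0 b0 e0.
  by rewrite big_seq1 !big_nil !mulr1 binavg0.
rewrite sum_wordsS binavgS.
apply: (@le_trans _ _ (\sum_(x <- A) binavg X n (revealed (a * p x) (b * q x) (e * w x)))).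
  apply: ler_sum => x _; under eq_bigr => s _ do rewrite !big_cons (mulrA a) (mulrA b) (mulrA e).
  by apply: IH; rewrite mulr_ge0.
by rewrite binavg_sum; apply: ler_binavg X01 _ => j _; apply: revealed_step.
Qed.

Lemma revealed1E j : revealed 1 1 1 j =
  if j is 0 then 0 else lam ^+ 2 / (lam + (1 - lam) / 2 ^+ j.-1).
Proof.
case: j => [|j] /=; first by rewrite edge_phi0E subrr mulr0 mul0r expr0n /= mul0r.
rewrite !edge_phi0E subr0 sub0r addr0 add0r mulrN mulNr sqrrN mulr1 -mulr2n div1r.
have -> : lam / 2 + (1 - lam) / 2 ^+ j.+1 = (lam + (1 - lam) / 2 ^+ j) / 2.
  by rewrite exprSr invfM mulrA -mulrDl.
move: (lam + _) => S; have [->|S0] := eqVneq S 0; first by rewrite mul0r invr0 !mulr0 mul0rn.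
by field.
Qed.

Lemma edge_sum0 n :
  \sum_(s <- words n A)
     edge_phi 0 (\prod_(x <- s) p x) (\prod_(x <- s) q x) (\prod_(x <- s) w x)
  <= binavg X n (fun j => if j is 0 then 0 else lam ^+ 2 / (lam + (1 - lam) / 2 ^+ j.-1)).
Proof.
have := @edge_chord n 1 1 1 ler01 ler01 ler01.
under eq_bigr => s _ do rewrite !mul1r.
by under eq_binavg => j do rewrite revealed1E.
Qed.

End Channels.

(** * Hyperedges with three children and small [lam] *)

Section ThreeChildren.
Variable R : realFieldType.
Implicit Types (lam t u v : R).

(** Half the difference of the products of the [1 + ti] and of the [1 - ti]; [pairs3] is their mean
    less 1. *)
Definition parity3 t1 t2 t3 : R := t1 + t2 + t3 + t1 * t2 * t3.
Definition pairs3 t1 t2 t3 : R := t1 * t2 + t2 * t3 + t1 * t3.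

(** With [z = lam * y], the bound [1 + z >= 7 / 8] gives [1 / (1 + z) <= 1 - z + 8 / 7 * z ^+ 2]
    and, since [(8 / 7) ^+ 3 < 3 / 2], the factor [1 / 2] on the quartic term. *)
Lemma gfun_expand lam (y N : R) : 0 <= lam <= 8^-1 -> -1 <= y ->
  gfun 3^-1 (1 + lam * y) (lam * N) <=
  lam ^+ 2 * (N ^+ 2 * (1 - lam * y + 8 / 7 * (lam * y) ^+ 2) + lam ^+ 2 * N ^+ 4 / 2).
Proof.
move=> hl hy; have hw : 7 / 8 <= 1 + lam * y by nra.
have w0 : 0 < 1 + lam * y by lra.
have l2 : 0 <= lam ^+ 2 by exact: sqr_ge0.
have n2 : 0 <= N ^+ 2 by exact: sqr_ge0.
have n4 : 0 <= N ^+ 4 by rewrite expr4 sqr_ge0.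
rewrite /gfun !(exprMn _ lam N) [leRHS]mulrDr; apply: lerD.
  rewrite -[leLHS]mulrA; apply: ler_wpM2l => //; apply: ler_wpM2l => //.
  rewrite -div1r ler_pdivrMr //.
  have : 0 <= (lam * y) ^+ 2 by exact: sqr_ge0.
  by nra.
have -> : 3^-1 * (lam ^+ 4 * N ^+ 4 / (1 + lam * y) ^+ 3)
   = lam ^+ 2 * (lam ^+ 2 * N ^+ 4 * (3^-1 / (1 + lam * y) ^+ 3)).
  by field; rewrite gt_eqF.
apply: ler_wpM2l => //; apply: ler_wpM2l; first by rewrite mulr_ge0.
rewrite ler_pdivrMr ?exprn_gt0 //.
have : (7 / 8) ^+ 3 <= (1 + lam * y) ^+ 3 by rewrite ler_pXn2r // nnegrE; lra.
lra.
Qed.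

(** The variables [u], [v], [w] stand for squared biases. At [lam = 0] this is [3 * e3 <= e2 <= S2];
    its slack and the negative linear term absorb the rest, using [lam ^+ 2 <= lam / 8]. *)
Lemma cubic_bound lam u v (w S S2 e2 e3 : R) :
  0 <= lam <= 8^-1 -> 0 <= u <= 1 -> 0 <= v <= 1 -> 0 <= w <= 1 ->
  S = u + v + w -> S2 = u ^+ 2 + v ^+ 2 + w ^+ 2 ->
  e2 = u * v + v * w + u * w -> e3 = u * v * w ->
  S + e3 - lam * (2 * e2 + 6 * e3)
  + 8 / 7 * lam ^+ 2 * (u * (v + w) ^+ 2 + v * (u + w) ^+ 2 + w * (u + v) ^+ 2
                        + 9 * e3 + 4 * e3 * S + e3 * e2)
  + lam ^+ 2 / 2 * (S2 + 6 * e2 + 24 * e3 + 6 * S * e3 + e3 ^+ 2)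
  <= S + (3^-1 - lam / 10) * S2.
Proof.
move=> hl hu hv hw ES ES2 Ee2 Ee3.
have uv : 0 <= u * v by nra. have vw : 0 <= v * w by nra. have uw : 0 <= u * w by nra.
have uv1 : u * v <= 1 by nra. have vw1 : v * w <= 1 by nra. have uw1 : u * w <= 1 by nra.
have e3w : u * v * w <= u * v by rewrite ler_piMr //; lra.
have e3u : u * v * w <= v * w by rewrite -mulrA ler_piMl //; lra.
have e3v : u * v * w <= u * w by rewrite mulrAC ler_piMr //; lra.
have e30 : 0 <= e3 by rewrite Ee3 mulr_ge0 //; lra.
have e2b : 3 * e3 <= e2 by rewrite Ee3 Ee2; lra.
have e2c : e2 <= 3 by rewrite Ee2; lra.
have e3b : e3 <= 1 by rewrite Ee3; lra.
have S2b : e2 <= S2.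
  rewrite Ee2 ES2; have := sqr_ge0 (u - v); have := sqr_ge0 (v - w); have := sqr_ge0 (u - w).
  lra.
have Sb : S <= 3 by rewrite ES; lra.
have a1 : u * (v + w) ^+ 2 + v * (u + w) ^+ 2 + w * (u + v) ^+ 2 <= 2 * e2 + 6 * e3.
  have m (x y : R) : 0 <= x * y -> 0 <= y <= 1 -> x * y * y <= x * y.
    by move=> xy hy; rewrite ler_piMr //; lra.
  have := (m _ _ uv hv, m _ _ vw hw, m _ _ uw hw).
  rewrite (mulrC u v) in uv; rewrite (mulrC v w) in vw; rewrite (mulrC u w) in uw.
  have := (m _ _ uv hu, m _ _ vw hv, m _ _ uw hu) => -[[i1 i2] i3] [[i4 i5] i6].
  rewrite Ee2 Ee3; lra.
have b1 : e3 * S <= 3 * e3 by nra.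
have b2 : e3 * e2 <= 3 * e3 by nra.
have b3 : e3 ^+ 2 <= e3 by nra.
clear ES ES2 Ee2 Ee3 hu hv hw uv vw uw uv1 vw1 uw1 e3w e3u e3v.
set A := (X in 8 / 7 * _ * X); set B := (X in lam ^+ 2 / 2 * X).
have hA : A <= 2 * e2 + 30 * e3 by rewrite /A; lra.
have hB : B <= S2 + 6 * e2 + 43 * e3 by rewrite /B; lra.
have l2 : 0 <= lam ^+ 2 by exact: sqr_ge0.
have l3 : lam ^+ 2 <= lam / 8 by nra.
have hA2 := ler_wpM2l l2 hA; have hB2 := ler_wpM2l l2 hB.
have T0 : 0 <= 8 / 7 * (2 * e2 + 30 * e3) + (S2 + 6 * e2 + 43 * e3) / 2 by lra.
have hT := ler_wpM2r T0 l3.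
have k1 : 0 <= lam * (e2 - 3 * e3) by nra.
have k2 : 0 <= (S2 - 3 * e3) * (8^-1 - lam) by nra.
have k3 : 0 <= lam * e3 by nra.
nra.
Qed.

Definition hyper3 lam t1 t2 t3 : R :=
  gfun 3^-1 (1 + lam * pairs3 t1 t2 t3) (lam * parity3 t1 t2 t3).
(** The integrand [t ^+ 2 + t ^+ 4 / 3] less a fraction of its quartic part; this loss becomes the
    gain in the recursion. *)
Definition deficit lam t : R := t ^+ 2 + (3^-1 - lam / 10) * t ^+ 4.

(** Flipping all three signs leaves [hyper3] unchanged, so these four patterns represent all eight.
    Averaging [gfun_expand] over them leaves the polynomial in squares of [cubic_bound]. *)
Lemma hyper3_unit lam t1 t2 t3 : 0 <= lam <= 8^-1 ->
  -1 <= t1 <= 1 -> -1 <= t2 <= 1 -> -1 <= t3 <= 1 ->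
  (hyper3 lam t1 t2 t3 + hyper3 lam (- t1) t2 t3 + hyper3 lam t1 (- t2) t3
     + hyper3 lam t1 t2 (- t3)) / 4
  <= lam ^+ 2 * (deficit lam t1 + deficit lam t2 + deficit lam t3).
Proof.
move=> hl h1 h2 h3.
have pb (x y z : R) : -1 <= x <= 1 -> -1 <= y <= 1 -> -1 <= z <= 1 -> -1 <= pairs3 x y z.
  move=> hx hy hz; rewrite /pairs3.
  have : 0 <= (1 + x) * (1 + y) * (1 + z) by rewrite !mulr_ge0 //; lra.
  have : 0 <= (1 - x) * (1 - y) * (1 - z) by rewrite !mulr_ge0 //; lra.
  lra.
have n1 : -1 <= - t1 <= 1 by lra.
have n2 : -1 <= - t2 <= 1 by lra.
have n3 : -1 <= - t3 <= 1 by lra.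
have G1 := gfun_expand (parity3 t1 t2 t3) hl (pb _ _ _ h1 h2 h3).
have G2 := gfun_expand (parity3 (- t1) t2 t3) hl (pb _ _ _ n1 h2 h3).
have G3 := gfun_expand (parity3 t1 (- t2) t3) hl (pb _ _ _ h1 n2 h3).
have G4 := gfun_expand (parity3 t1 t2 (- t3)) hl (pb _ _ _ h1 h2 n3).
have sq (x : R) : -1 <= x <= 1 -> 0 <= x ^+ 2 <= 1 by move=> *; nra.
have := cubic_bound hl (sq _ h1) (sq _ h2) (sq _ h3) erefl erefl erefl erefl.
move=> /(ler_wpM2l (sqr_ge0 lam)) C.
have -> : lam ^+ 2 * (deficit lam t1 + deficit lam t2 + deficit lam t3) =
   lam ^+ 2 * (t1 ^+ 2 + t2 ^+ 2 + t3 ^+ 2 +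
     (3^-1 - lam / 10) * ((t1 ^+ 2) ^+ 2 + (t2 ^+ 2) ^+ 2 + (t3 ^+ 2) ^+ 2)).
  by rewrite /deficit; field.
apply: le_trans C; rewrite ler_pdivrMr //.
apply: le_trans (lerD (lerD (lerD G1 G2) G3) G4) _.
rewrite le_eqVlt; apply/orP; left; apply/eqP.
by rewrite /pairs3 /parity3; field.
Qed.

Variables (T : Type) (A : seq T) (p q : T -> R).
Hypotheses (p0 : forall x, 0 <= p x) (q0 : forall x, 0 <= q x).
Hypothesis sym : forall F : R -> R -> R,
  \sum_(x <- A) F (p x) (q x) = \sum_(x <- A) F (q x) (p x).
Hypothesis mass : \sum_(x <- A) (p x + q x) / 2 <= 1.

Let w x := (p x + q x) / 2.

Definition quart (a b : R) : R := ((a - b) / 2) ^+ 4 / ((a + b) / 2) ^+ 3.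

Lemma quart_polar v t : quart (v * (1 + t)) (v * (1 - t)) = v * t ^+ 4.
Proof.
rewrite /quart; have -> : (v * (1 + t) - v * (1 - t)) / 2 = v * t by field.
have -> : (v * (1 + t) + v * (1 - t)) / 2 = v by field.
by have [->|vn] := eqVneq v 0; [rewrite !mul0r expr0n mul0r|field].
Qed.

Lemma phi0_polar v t : phi 0 (v * (1 + t)) (v * (1 - t)) = v * t ^+ 2.
Proof. by rewrite phi_polar /gfun mul0r addr0 divr1. Qed.

Lemma quart_le (a b : R) : 0 <= a -> 0 <= b -> quart a b <= phi 0 a b.
Proof.
move=> /ratio_bound H /H{H}[v [t [v0 ht -> ->]]].
rewrite quart_polar phi0_polar ler_wpM2l // expr4.
have : 0 <= t ^+ 2 <= 1 by nra.
nra.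
Qed.

Lemma phi_quart c a b : phi c a b = phi 0 a b + c * quart a b.
Proof. by rewrite /phi /quart mul0r addr0. Qed.

Lemma hyper3_step lam (a1 b1 a2 b2 a3 b3 : R) : 0 <= lam <= 8^-1 ->
  0 <= a1 -> 0 <= b1 -> 0 <= a2 -> 0 <= b2 -> 0 <= a3 -> 0 <= b3 ->
  let w1 := (a1 + b1) / 2 in let w2 := (a2 + b2) / 2 in let w3 := (a3 + b3) / 2 in
  let E x1 y1 x2 y2 x3 y3 := edge_phi lam 3^-1 (x1 * (x2 * x3)) (y1 * (y2 * y3)) (w1 * (w2 * w3)) in
  let h := phi (3^-1 - lam / 10) in
  ((E a1 b1 a2 b2 a3 b3 + E b1 a1 a2 b2 a3 b3 + E a1 b1 b2 a2 a3 b3 + E a1 b1 a2 b2 b3 a3) / 4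
  <= lam ^+ 2 * (w2 * w3 * h a1 b1 + w1 * w3 * h a2 b2 + w1 * w2 * h a3 b3)) : Prop.
Proof.
move=> hl /ratio_bound H /H{H}[v1 [t1 [v10 h1 -> ->]]].
move=> /ratio_bound H /H{H}[v2 [t2 [v20 h2 -> ->]]].
move=> /ratio_bound H /H{H}[v3 [t3 [v30 h3 -> ->]]] /=.
have wE v t : (v * (1 + t) + v * (1 - t)) / 2 = v :> R by field.
rewrite !wE !phi_polar.
have hd t : gfun (3^-1 - lam / 10) 1 t = deficit lam t by rewrite /gfun /deficit !expr1n !divr1.
have key x y z : edge_phi lam 3^-1 (v1 * (1 + x) * (v2 * (1 + y) * (v3 * (1 + z))))
    (v1 * (1 - x) * (v2 * (1 - y) * (v3 * (1 - z)))) (v1 * (v2 * v3))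
  = v1 * v2 * v3 * hyper3 lam x y z.
  by rewrite /edge_phi phiE /hyper3 -gfunZ /pairs3 /parity3; congr gfun; field.
have k1 := key t1 t2 t3.
have k2 := key (- t1) t2 t3; have k3 := key t1 (- t2) t3; have k4 := key t1 t2 (- t3).
rewrite ?opprK in k1 k2 k3 k4; rewrite k1 k2 k3 k4 !hd.
have := ler_wpM2l (mulr_ge0 (mulr_ge0 v10 v20) v30) (hyper3_unit hl h1 h2 h3).
lra.
Qed.

(** Applying [sym] to each letter separately gives three equal sums; averaged with the original they
    form the four patterns of [hyper3_step]. The two masses left as factors are at most 1. *)
Lemma edge_sum3 lam : 0 <= lam <= 8^-1 ->
  \sum_(s <- words 3 A)
     edge_phi lam 3^-1 (\prod_(x <- s) p x) (\prod_(x <- s) q x) (\prod_(x <- s) w x)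
  <= 3 * lam ^+ 2 * \sum_(x <- A) phi (3^-1 - lam / 10) (p x) (q x).
Proof.
move=> hl; set h := phi _; set H := \sum_(x <- A) h _ _.
pose E x1 y1 x2 y2 x3 y3 := edge_phi lam 3^-1 (x1 * (x2 * x3)) (y1 * (y2 * y3))
  ((x1 + y1) / 2 * ((x2 + y2) / 2 * ((x3 + y3) / 2))).
pose S f := \sum_(x <- A) \sum_(y <- A) \sum_(z <- A) f x y z : R.
have -> : \sum_(s <- words 3 A)
     edge_phi lam 3^-1 (\prod_(x <- s) p x) (\prod_(x <- s) q x) (\prod_(x <- s) w x)
   = S (fun x y z => E (p x) (q x) (p y) (q y) (p z) (q z)).
  rewrite sum_wordsS; apply: eq_bigr => x _; rewrite sum_wordsS; apply: eq_bigr => y _.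
  by rewrite sum_wordsS; apply: eq_bigr => z _; rewrite big_seq1 !big_cons !big_nil !mulr1.
set T0 := S _.
have e1 : T0 = S (fun x y z => E (q x) (p x) (p y) (q y) (p z) (q z)).
  exact: (sym (fun a b => \sum_(y <- A) \sum_(z <- A) E a b (p y) (q y) (p z) (q z))).
have e2 : T0 = S (fun x y z => E (p x) (q x) (q y) (p y) (p z) (q z)).
  apply: eq_bigr => x _.
  exact: (sym (fun a b => \sum_(z <- A) E (p x) (q x) a b (p z) (q z))).
have e3 : T0 = S (fun x y z => E (p x) (q x) (p y) (q y) (q z) (p z)).
  by apply: eq_bigr => x _; apply: eq_bigr => y _; exact: (sym (fun a b => E (p x) (q x) (p y) (q y) a b)).
have -> : T0 = S (fun x y z => (E (p x) (q x) (p y) (q y) (p z) (q z) + E (q x) (p x) (p y) (q y) (p z) (q z)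
   + E (p x) (q x) (q y) (p y) (p z) (q z) + E (p x) (q x) (p y) (q y) (q z) (p z)) / 4).
  have -> : T0 = (T0 + T0 + T0 + T0) / 4 by field.
  rewrite {2}e1 {2}e2 {2}e3 /T0 /S -!big_split /= mulr_suml; apply: eq_bigr => x _.
  by rewrite -!big_split /= mulr_suml; apply: eq_bigr => y _; rewrite -!big_split /= mulr_suml.
apply: (@le_trans _ _ (S (fun x y z => lam ^+ 2 * (w y * w z * h (p x) (q x) + w x * w z * h (p y) (q y)
   + w x * w y * h (p z) (q z))))).
  apply: ler_sum => x _; apply: ler_sum => y _; apply: ler_sum => z _.
  have := @hyper3_step lam (p x) (q x) (p y) (q y) (p z) (q z) hl (p0 x) (q0 x) (p0 y) (q0 y) (p0 z) (q0 z).
  by rewrite /E /= ![q _ + p _]addrC.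
pose M := \sum_(x <- A) w x.
have M0 : 0 <= M by apply: sumr_ge0 => x _; rewrite /w divr_ge0 // addr_ge0.
have H0 : 0 <= H.
  by apply: sumr_ge0 => x _; apply: phi_ge0 => //; lra.
have -> : S (fun x y z => lam ^+ 2 * (w y * w z * h (p x) (q x) + w x * w z * h (p y) (q y)
   + w x * w y * h (p z) (q z))) = 3 * lam ^+ 2 * (M ^+ 2 * H).
  pose k x := h (p x) (q x).
  have lin a b : \sum_(z <- A) lam ^+ 2 * (a * w z + b * k z) = lam ^+ 2 * (a * M + b * H).
    by rewrite -mulr_sumr big_split /= -!mulr_sumr.
  have -> : 3 * lam ^+ 2 * (M ^+ 2 * H) = lam ^+ 2 * ((2 * H * M) * M + (M ^+ 2) * H) by ring.
  rewrite -lin /S; apply: eq_bigr => x _.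
  have -> : lam ^+ 2 * (2 * H * M * w x + M ^+ 2 * k x)
    = lam ^+ 2 * ((k x * M + w x * H) * M + (w x * M) * H) by ring.
  rewrite -lin; apply: eq_bigr => y _.
  have -> : lam ^+ 2 * ((k x * M + w x * H) * w y + w x * M * k y)
    = lam ^+ 2 * ((w y * k x + w x * k y) * M + (w x * w y) * H) by ring.
  by rewrite -lin; apply: eq_bigr => z _; rewrite -/(k x) -/(k y) -/(k z); ring.
apply: ler_wpM2l; first by rewrite mulr_ge0 ?sqr_ge0.
by rewrite ler_piMl // expr_le1.
Qed.

(** Second moment against squared mean for [theta ^+ 2]: sum [w * (theta ^+ 2 - X) ^+ 2 >= 0], with
    total mass at most 1. *)
Lemma sum_quart_ge : (\sum_(x <- A) phi 0 (p x) (q x)) ^+ 2 <= \sum_(x <- A) quart (p x) (q x).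
Proof.
set X := \sum_(x <- A) phi _ _ _.
have : 0 <= \sum_(x <- A) (quart (p x) (q x) - 2 * X * phi 0 (p x) (q x) + X ^+ 2 * w x).
  apply: sumr_ge0 => x _.
  rewrite /w; have [v [t [v0 _ -> ->]]] := ratio_bound (p0 x) (q0 x).
  rewrite quart_polar phi0_polar.
  have -> : v * t ^+ 4 - 2 * X * (v * t ^+ 2) + X ^+ 2 * ((v * (1 + t) + v * (1 - t)) / 2)
    = v * (t ^+ 2 - X) ^+ 2 by field.
  by rewrite mulr_ge0 ?sqr_ge0.
rewrite big_split sumrB /= -!mulr_sumr -/X.
have := ler_wpM2l (sqr_ge0 X) mass; lra.
Qed.

End ThreeChildren.

(** * Information carried by revealed children *)

Section RevealedInformation.
Variable R : realFieldType.
Implicit Types (lam X eta : R) (n j : nat).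

Definition reveal lam j : R := if j is 0 then 0 else lam ^+ 2 / (lam + (1 - lam) / 2 ^+ j.-1).

Lemma reveal_ge0 lam j : 0 <= lam <= 1 -> 0 <= reveal lam j.
Proof.
move=> hl; case: j => [|j] //=; apply: divr_ge0; first exact: sqr_ge0.
by apply: addr_ge0; [lra|apply: divr_ge0; [lra|rewrite exprn_ge0]].
Qed.

(** The factorial moments turn a loss [eta * j * (j - 1)] into the gain in [X ^+ 2]. *)
Lemma binavg_reveal_le lam X eta n : 0 <= X <= 1 ->
  (forall j, (j <= n)%N -> reveal lam j <= lam ^+ 2 * (j%:R - eta * (j%:R * (j%:R - 1)))) ->
  binavg X n (reveal lam) <= n%:R * lam ^+ 2 * (X - eta * (n%:R - 1) * X ^+ 2).
Proof.
move=> hX hj.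
apply: (@le_trans _ _ (binavg X n (fun j => 0 + lam ^+ 2 * j%:R + (- (lam ^+ 2 * eta)) * (j%:R * (j%:R - 1))))).
  by apply: ler_binavg => // j /hj h; apply: le_trans h _; rewrite le_eqVlt; apply/orP; left; apply/eqP; ring.
by rewrite binavg_quad le_eqVlt; apply/orP; left; apply/eqP; ring.
Qed.

Lemma reveal_le lam j (B : R) : 0 <= lam <= 1 -> 0 <= B ->
  1 <= B * (lam + (1 - lam) / 2 ^+ j) -> reveal lam j.+1 <= lam ^+ 2 * B.
Proof.
move=> hl B0 hB /=; set s := lam + _ in hB *.
have s0 : 0 < s by rewrite ltNge; apply/negP => h; have := mulr_ge0_le0 B0 h; lra.
by apply: ler_wpM2l; [exact: sqr_ge0|rewrite -div1r ler_pdivrMr].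
Qed.

Lemma reveal_two lam j : 0 <= lam <= 1 -> (j <= 2)%N ->
  reveal lam j <= lam ^+ 2 * (j%:R - 3 / 8 * lam * (j%:R * (j%:R - 1))).
Proof.
move=> hl; case: j => [|[|[|//]]] _.
- by rewrite /= mul0r mulr0 subrr mulr0.
- by apply: reveal_le => //; rewrite ?expr0; lra.
- by apply: reveal_le => //; rewrite ?expr1; nra.
Qed.

(** The factor for [j = 3] is [4 / (1 + 3 * lam)], below 3 exactly when [lam > 1 / 9]; the threshold
    [8^-1] leaves room for a loss. *)
Lemma reveal_three lam j : 8^-1 <= lam <= 1 -> (j <= 3)%N ->
  reveal lam j <= lam ^+ 2 * (j%:R - 100^-1 * (j%:R * (j%:R - 1))).
Proof.
move=> hl; case: j => [|[|[|[|//]]]] _.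
- by rewrite /= mul0r mulr0 subrr mulr0.
- by apply: reveal_le => //; rewrite ?expr0; lra.
- by apply: reveal_le => //; rewrite ?expr1; lra.
- by apply: reveal_le => //; lra.
Qed.

(** The coefficient keeps the loss at most [5^-1] for every [j <= n], so for [j >= 2] it suffices to
    compare with [j - 5^-1]. *)
Lemma reveal_many lam n j : 5^-1 <= lam <= 1 -> (2 <= n)%N -> (j <= n)%N ->
  reveal lam j <= lam ^+ 2 * (j%:R - (5 * n%:R * (n%:R - 1))^-1 * (j%:R * (j%:R - 1))).
Proof.
move=> hl n2 jn; have hl1 : 0 <= lam <= 1 by lra.
have n2R : 2 <= n%:R :> R by rewrite (ler_nat R 2).
have jnR : j%:R <= n%:R :> R by rewrite ler_nat.
have Dp : 0 < 5 * n%:R * (n%:R - 1) :> R by rewrite !mulr_gt0 //; lra.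
case: j jn jnR => [|[|j]] jn jnR.
- by rewrite /= mul0r mulr0 subrr mulr0.
- by apply: reveal_le => //; rewrite ?expr0; lra.
have j2 : 2 <= j.+2%:R :> R by rewrite (ler_nat R 2).
have gap : (5 * n%:R * (n%:R - 1))^-1 * (j.+2%:R * (j.+2%:R - 1)) <= 5^-1 :> R.
  by rewrite mulrC ler_pdivrMr //; nra.
set g := _^-1 * _ in gap *.
apply: (@le_trans _ _ (lam ^+ 2 * (j.+2%:R - 5^-1))); last first.
  by apply: ler_wpM2l; [exact: sqr_ge0|lra].
apply: reveal_le => //; first lra.
(* The counts 2 to 5 are checked one by one; from 6 on, [1 / lam <= 5] suffices. *)
case: j {jn jnR gap g} j2 => [|[|[|[|j]]]] j2; rewrite ?expr1; try lra.
have jR : 6 <= j.+4.+2%:R :> R by rewrite (ler_nat R 6).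
have : 0 <= (1 - lam) / 2 ^+ j.+4.+1 by rewrite divr_ge0 ?exprn_ge0 //; lra.
move: (_ / 2 ^+ _) => s s0; nra.
Qed.

End RevealedInformation.

(** * Observation trees and finite boxes of them *)

Section Trees.
Local Notation tree := (GenTree.tree bool).

Fixpoint flip (o : tree) : tree :=
  match o with
  | GenTree.Leaf b => GenTree.Leaf (~~ b)
  | GenTree.Node m l => GenTree.Node m (map flip l)
  end.

Lemma flipK : involutive flip.
Proof.
elim=> [b|m l IH] /=; first by rewrite negbK.
by congr GenTree.Node; elim: l IH => //= x l IHl [-> /IHl ->].
Qed.

Definition node (l : seq tree) : tree := GenTree.Node 0 l.
Definition kids (o : tree) := if o is GenTree.Node _ l then l else [::].
Definition root0 (o : tree) := if o is GenTree.Node 0 _ then true else false.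

Lemma root0E o : root0 o -> o = node (kids o).
Proof. by case: o => // -[]. Qed.

Definition edge_shape n (h : tree) := root0 h && (size (kids h) == n).
(** Checks only the two layers that one unfolding of [lik] inspects; deeper malformations are left
    to the likelihoods of the subtrees. *)
Definition obs_shape n (o : tree) := root0 o && all (edge_shape n) (kids o).

Lemma flip_closure (A : seq tree) : exists A',
  [/\ uniq A', perm_eq (map flip A') A' & {subset A <= A'}].
Proof.
exists (undup (A ++ map flip A)); split; first exact: undup_uniq.
- apply: uniq_perm; rewrite ?(map_inj_uniq (inv_inj flipK)) ?undup_uniq // => o.
  have flipE (s : seq tree) : (o \in map flip s) = (flip o \in s).
    by rewrite -{1}(flipK o) (mem_map (inv_inj flipK)).
  by rewrite flipE !mem_undup !mem_cat flipE (mem_map (inv_inj flipK)) orbC.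
- by move=> o oA; rewrite mem_undup mem_cat oA.
Qed.

Lemma ler_sum_sub (R : realFieldType) (T : eqType) (A B : seq T) (F : T -> R) :
  (forall x, 0 <= F x) -> uniq A -> (forall x, x \in A -> F x != 0 -> x \in B) ->
  \sum_(x <- A) F x <= \sum_(x <- B) F x.
Proof.
move=> F0; elim: A B => [|x A IH] B /=; first by rewrite big_nil sumr_ge0.
move=> /andP[xA uA] sub; rewrite big_cons; have [->|Fx] := eqVneq (F x) 0.
  by rewrite add0r; apply: IH => // y yA; apply: sub; rewrite inE yA orbT.
have xB : x \in B by apply: sub; rewrite ?inE ?eqxx.
rewrite (big_rem x xB) lerD2l; apply: IH => // y yA Fy.
have : y \in B by apply: sub => //; rewrite inE yA orbT.
rewrite (perm_mem (perm_to_rem xB)) inE => /orP[/eqP yx|//].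
by rewrite yx (negbTE xA) in yA.
Qed.

(** Up to null terms, a finite set of observations sits in a box: fewer than [N] hyperedges, each a
    word of length [n] over one flip-closed set of child subtrees. Sums of products factor over such
    a box. *)
Lemma sum_box (R : realFieldType) n (A : seq tree) : uniq A -> exists N A',
  [/\ uniq A', perm_eq (map flip A') A' &
   forall F : tree -> R, (forall o, 0 <= F o) -> (forall o, ~~ obs_shape n o -> F o = 0) ->
   \sum_(o <- A) F o <=
   \sum_(t < N) \sum_(hs <- words t (map node (words n A'))) F (node hs)].
Proof.
move=> uA; pose K := flatten (map kids (flatten (map kids A))).
have [A' [uA' pA' sA']] := flip_closure K.
exists (\max_(o <- A) size (kids o)).+1, A'; split=> // F F0 Fs.
set N := _.+1; pose W t := words t (map node (words n A')).
have -> : \sum_(t < N) \sum_(hs <- W t) F (node hs) =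
  \sum_(o <- flatten [seq map node (W t) | t <- iota 0 N]) F o.
  rewrite big_flatten big_map -(big_mkord xpredT (fun t => \sum_(hs <- W t) F (node hs))).
  rewrite /index_iota subn0.
  by apply: eq_bigr => t _; rewrite big_map.
apply: ler_sum_sub => // o oA Fo.
have /andP[/root0E oE /allP sh] : obs_shape n o by apply: contraNT Fo => /Fs ->.
apply/flattenP; exists (map node (W (size (kids o)))).
  by apply/mapP; exists (size (kids o)) => //; rewrite mem_iota add0n /N ltnS /=; apply: leq_bigmax_seq.
rewrite oE /=; apply/mapP; exists (kids o) => //.
rewrite mem_words eqxx /=; apply/allP => h hK.
have /andP[/root0E hE sz] := sh _ hK; rewrite inE hE map_f // mem_words sz /=.
apply/allP => c cK; apply: sA'; apply/flattenP; exists (kids h) => //.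
by apply/map_f/flattenP; exists (kids o) => //; apply: map_f.
Qed.

End Trees.

(** * Likelihoods, their mass, and one generation of the recursion *)

Section Likelihoods.
Variables (R : realType) (r : nat) (lam : R) (D : nat -> R).
Hypotheses (lam01 : 0 <= lam <= 1) (D0 : forall t, 0 <= D t).
Local Notation tree := (GenTree.tree bool).
Local Notation n := r.-1.
Local Notation L := (lik r lam D).

Definition edge_lik k (s : bool) (h : tree) : R :=
  match h with
  | GenTree.Node 0 cs =>
      if size cs == n then
        \sum_(x : n.-tuple bool)
           Bker lam x s * \prod_(i < n) L k (tnth x i) (nth (GenTree.Leaf false) cs i)
      else 0
  | _ => 0
  end.

Lemma likS k s o : L k.+1 s o =
  if root0 o then D (size (kids o)) * \prod_(h <- kids o) edge_lik k s h else 0.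
Proof. by case: o => [b|[|m] l]. Qed.

Definition wlik k o : R := (L k true o + L k false o) / 2.

Lemma prod_nth (cs : seq tree) (F : tree -> R) : size cs = n ->
  \prod_(i < n) F (nth (GenTree.Leaf false) cs i) = \prod_(o <- cs) F o.
Proof. by move=> <-; rewrite (big_nth (GenTree.Leaf false)) big_mkord. Qed.

(** [Bker] is a mixture: with weight [lam] all children copy [s], otherwise their labels are
    independent and uniform, and the sum over labellings factors into averages. *)
Lemma edge_likE k s cs : size cs = n ->
  edge_lik k s (node cs) = lam * \prod_(o <- cs) L k s o + (1 - lam) * \prod_(o <- cs) wlik k o.
Proof.
move=> sz; rewrite /edge_lik /= sz eqxx /Bker.
under eq_bigr => x _ do rewrite mulrDl.
rewrite big_split /=; congr (_ + _).
  rewrite (bigD1 (nseq_tuple n s)) //= [X in _ + X]big1 ?addr0 => [|x xs].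
    rewrite all_pred1_nseq -prod_nth //.
    by congr (_ * _); apply: eq_bigr => i _; rewrite (tnth_nth s) nth_nseq ltn_ord.
  case: ifP => [/all_pred1P xE|]; last by rewrite mul0r.
  by case/eqP: xs; apply: val_inj; rewrite /= xE size_tuple.
rewrite -mulr_sumr [_^-1 * _]mulrC -mulrA; congr (_ * _).
(* Labellings become functions, so that the sum of products distributes as a product of sums. *)
rewrite (reindex (fun f : {ffun 'I_n -> bool} => [tuple f i | i < n])) /=; last first.
  exists (fun t : n.-tuple bool => [ffun i => tnth t i]) => f _.
    by apply/ffunP => i; rewrite ffunE tnth_mktuple.
  by apply: eq_from_tnth => i; rewrite tnth_mktuple ffunE.
under eq_bigr => f _ do under eq_bigr => i _ do rewrite tnth_mktuple.
rewrite -(bigA_distr_bigA (fun (i : 'I_n) (b : bool) => L k b (nth (GenTree.Leaf false) cs i))).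
under eq_bigr => i _ do rewrite big_bool /=.
rewrite (@prod_nth _ (fun o => L k true o + L k false o)) // /wlik.
by rewrite big_split /= big_const_seq count_predT iter_mulr_1 sz exprVn mulrC.
Qed.

Lemma edge_lik_shape k s h : ~~ edge_shape n h -> edge_lik k s h = 0.
Proof. by case: h => [b|[|m] l] //; rewrite /edge_shape /= => /negbTE ->. Qed.

Lemma lik_shape k s o : ~~ obs_shape n o -> L k.+1 s o = 0.
Proof.
rewrite likS /obs_shape; case: root0 => //= nsh.
suff /eqP -> : \prod_(h <- kids o) edge_lik k s h == 0 by rewrite mulr0.
rewrite prodf_seq_eq0; move: nsh; rewrite -has_predC; apply: sub_has => h /=.
by move=> /edge_lik_shape ->.
Qed.

Lemma edge_lik_ge0_of k s : (forall s o, 0 <= L k s o) -> forall h, 0 <= edge_lik k s h.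
Proof.
move=> L0 h; have [/andP[/root0E -> /eqP sz]|/edge_lik_shape -> //] := boolP (edge_shape n h).
have [l0 l1] : 0 <= lam /\ 0 <= 1 - lam by move: lam01; lra.
by rewrite edge_likE // addr_ge0 // mulr_ge0 // prodr_ge0 // => o _; rewrite divr_ge0 // addr_ge0.
Qed.

Lemma lik_ge0 k s o : 0 <= L k s o.
Proof.
elim: k s o => [|k IH] s o; first by case: o => //= b; rewrite ler0n.
by rewrite likS; case: ifP => // _; rewrite mulr_ge0 // prodr_ge0 // => h _; apply: edge_lik_ge0_of.
Qed.

Lemma edge_lik_ge0 k s h : 0 <= edge_lik k s h.
Proof. exact/edge_lik_ge0_of/lik_ge0. Qed.

Lemma wlik_ge0 k o : 0 <= wlik k o.
Proof. by rewrite divr_ge0 // addr_ge0 // lik_ge0. Qed.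

Lemma lik_flip k s o : L k s (flip o) = L k (~~ s) o.
Proof.
elim: k s o => [|k IH] s o; first by case: o => //= b; rewrite -[s in LHS]negbK (inj_eq negb_inj).
rewrite !likS; case: o => [b|[|m] l] //=; rewrite size_map big_map; congr (_ * _).
apply: eq_bigr => h _.
have [/andP[/root0E -> /eqP sz]|nsh] := boolP (edge_shape n h); last first.
  by rewrite !edge_lik_shape //; case: h nsh => [b|[|m] cs] //; rewrite /edge_shape /= size_map.
rewrite [flip _]/(node (map flip (kids h))) !edge_likE ?size_map // !big_map.
congr (_ * _ + _ * _); apply: eq_bigr => o _ //.
by rewrite /wlik !IH /= addrC.
Qed.

Lemma sum_flip k (A : seq tree) (F : R -> R -> R) : perm_eq (map flip A) A ->
  \sum_(o <- A) F (L k true o) (L k false o) = \sum_(o <- A) F (L k false o) (L k true o).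
Proof.
move=> pA; rewrite -(perm_big _ pA) big_map /=.
by apply: eq_bigr => o _; rewrite !lik_flip.
Qed.

Lemma sum_edges (A : seq tree) k (F : R -> R -> R) :
  \sum_(h <- map node (words n A)) F (edge_lik k true h) (edge_lik k false h)
  = \sum_(cs <- words n A) F
      (lam * \prod_(o <- cs) L k true o + (1 - lam) * \prod_(o <- cs) wlik k o)
      (lam * \prod_(o <- cs) L k false o + (1 - lam) * \prod_(o <- cs) wlik k o).
Proof.
rewrite big_map; apply: eq_big_seq => cs; rewrite mem_words => /andP[/eqP sz _].
by rewrite !edge_likE.
Qed.

Lemma edge_flip k (A : seq tree) (F : R -> R -> R) : perm_eq (map flip A) A ->
  \sum_(h <- map node (words n A)) F (edge_lik k true h) (edge_lik k false h)
  = \sum_(h <- map node (words n A)) F (edge_lik k false h) (edge_lik k true h).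
Proof.
move=> pA; rewrite sum_edges (sum_edges A k (fun a b => F b a)).
exact: (words_sym (fun G => sum_flip k G pA) n
  (fun a b c => F (lam * a + (1 - lam) * c) (lam * b + (1 - lam) * c))).
Qed.

Hypothesis D1 : forall N, \sum_(t < N) D t <= 1.

Lemma edge_mass k s (A : seq tree) : (forall s', \sum_(o <- A) L k s' o <= 1) ->
  \sum_(h <- map node (words n A)) edge_lik k s h <= 1.
Proof.
move=> m; have [l0 l1] : 0 <= lam /\ 0 <= 1 - lam by move: lam01; lra.
have -> : \sum_(h <- map node (words n A)) edge_lik k s h =
   lam * (\sum_(o <- A) L k s o) ^+ n + (1 - lam) * (\sum_(o <- A) wlik k o) ^+ n.
  rewrite -!sum_words_prod !mulr_sumr -big_split big_map; apply: eq_big_seq => cs.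
  by rewrite mem_words => /andP[/eqP sz _]; rewrite edge_likE.
have h1 : (\sum_(o <- A) L k s o) ^+ n <= 1.
  by rewrite exprn_ile1 // sumr_ge0 // => o _; apply: lik_ge0.
have h2 : (\sum_(o <- A) wlik k o) ^+ n <= 1.
  rewrite exprn_ile1 //; first by rewrite sumr_ge0 // => o _; apply: wlik_ge0.
  by rewrite -mulr_suml big_split /=; move: (m true) (m false); lra.
have := lerD (ler_wpM2l l0 h1) (ler_wpM2l l1 h2); lra.
Qed.

(** On a box the mass is the sum over [t] of [D t] times the [t]-th power of the hyperedge mass,
    which is at most 1 by induction. *)
Lemma lik_mass k s (A : seq tree) : uniq A -> \sum_(o <- A) L k s o <= 1.
Proof.
elim: k s A => [|k IH] s A uA.
  apply: le_trans (ler_sum_sub (B := [:: GenTree.Leaf s]) _ uA _) _.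
  - exact: lik_ge0.
  - case=> [b|m l] _ /=; last by rewrite eqxx.
    by rewrite inE pnatr_eq0 eqb0 negbK => /eqP ->.
  - by rewrite big_seq1 /= eqxx.
have [N [A' [uA' pA' box]]] := sum_box R n uA.
apply: le_trans (box _ (lik_ge0 k.+1 s) (lik_shape k s)) _.
apply: le_trans (D1 N); apply: ler_sum => t _.
have sz hs : hs \in words t (map node (words n A')) ->
    L k.+1 s (node hs) = D t * \prod_(h <- hs) edge_lik k s h.
  by rewrite mem_words => /andP[/eqP st _]; rewrite likS /= st.
rewrite (eq_big_seq _ sz) -mulr_sumr sum_words_prod -[leRHS]mulr1 ler_wpM2l //.
rewrite exprn_ile1 //; first by rewrite sumr_ge0 // => h _; apply: edge_lik_ge0.
by apply: edge_mass => s'; apply: IH.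
Qed.

Lemma half_mass (T : Type) (A : seq T) (f g : T -> R) :
  \sum_(x <- A) f x <= 1 -> \sum_(x <- A) g x <= 1 -> \sum_(x <- A) (f x + g x) / 2 <= 1.
Proof. by rewrite -mulr_suml big_split /=; lra. Qed.

Definition info c k (A : seq tree) : R := \sum_(o <- A) phi c (L k true o) (L k false o).

Lemma info_ge0 c k A : 0 <= c -> 0 <= info c k A.
Proof. by move=> c0; apply: sumr_ge0 => o _; rewrite phi_ge0 ?lik_ge0. Qed.

Lemma info_ub c k A : 0 <= c -> uniq A -> info c k A <= 1 + c.
Proof.
move=> c0 uA; have m := half_mass (lik_mass k true uA) (lik_mass k false uA).
apply: (@le_trans _ _ ((1 + c) * \sum_(o <- A) (L k true o + L k false o) / 2)).
  by rewrite mulr_sumr; apply: ler_sum => o _; rewrite phi_ub ?lik_ge0.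
by rewrite -[leRHS]mulr1 ler_wpM2l // addr_ge0.
Qed.

Definition edge_info c k (A : seq tree) : R :=
  \sum_(cs <- words n A) edge_phi lam c (\prod_(o <- cs) L k true o)
     (\prod_(o <- cs) L k false o) (\prod_(o <- cs) wlik k o).

Variable d : R.
Hypothesis Dd : forall N, \sum_(t < N) t%:R * D t <= d.

(** On a box, subadditivity charges a vertex with [t] hyperedges [t] times the information of one;
    averaging over [D] gives the factor [d]. *)
Lemma info_step c k (A : seq tree) : 0 <= c <= 3^-1 -> uniq A ->
  exists2 A', uniq A' /\ perm_eq (map flip A') A' & info c k.+1 A <= d * edge_info c k A'.
Proof.
move=> hc uA; have c0 : 0 <= c by lra.
have [N [A' [uA' pA' box]]] := sum_box R n uA; exists A' => //.
apply: le_trans (box (fun o => phi c (L k.+1 true o) (L k.+1 false o)) _ _) _.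
- by move=> o; rewrite phi_ge0 ?lik_ge0.
(* Malformed codes have both likelihoods [0]; homogeneity with factor [0] shows that they contribute
   nothing. *)
- by move=> o /lik_shape sh; rewrite !sh -[0]/(0%:R) -[X in phi c X _](mul0r 0) -[X in phi c _ X](mul0r 0) phiZ mul0r.
have e0 : 0 <= edge_info c k A'.
  apply: sumr_ge0 => cs _; apply: edge_phi_ge0 => //; apply: prodr_ge0 => o _; rewrite ?lik_ge0 //.
  exact: wlik_ge0.
apply: (@le_trans _ _ (\sum_(t < N) t%:R * D t * edge_info c k A')); last first.
  by rewrite -mulr_suml ler_wpM2r.
apply: ler_sum => t _.
have sz hs : hs \in words t (map node (words n A')) ->
    phi c (L k.+1 true (node hs)) (L k.+1 false (node hs))
    = D t * phi c (\prod_(h <- hs) edge_lik k true h) (\prod_(h <- hs) edge_lik k false h).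
  by rewrite mem_words => /andP[/eqP st _]; rewrite !likS /= st phiZ.
rewrite (eq_big_seq _ sz) -mulr_sumr [t%:R * _]mulrC -mulrA ler_wpM2l //.
have m s : \sum_(h <- map node (words n A')) edge_lik k s h <= 1.
  by apply: edge_mass => s'; apply: lik_mass.
have := phi_sum_words_le (edge_lik_ge0 k true) (edge_lik_ge0 k false)
  (fun F => edge_flip k F pA') (half_mass (m true) (m false)) t hc.
by rewrite sum_edges.
Qed.

End Likelihoods.

(** * Decay of the information in each regime *)

Section Decay.
Variables (R : realType) (r : nat) (lam : R) (D : nat -> R) (d : R).
Hypotheses (lam01 : 0 <= lam <= 1) (Ddistr : is_distr D) (Dmean : has_mean D d).
Local Notation tree := (GenTree.tree bool).
Local Notation n := r.-1.
Local Notation L := (lik r lam D).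
Local Notation info := (info r lam D).
Local Notation edge_info := (edge_info r lam D).

Implicit Types (c : R) (A : seq tree).

Let D0 t : 0 <= D t. Proof. by case: Ddistr. Qed.

Lemma partial_sum_le (u : nat -> R) (l : R) N : (forall t, 0 <= u t) ->
  (fun M => \sum_(t < M) u t) @ \oo --> l -> \sum_(t < N) u t <= l.
Proof.
move=> u0 ul; have <- := cvg_lim (@Rhausdorff R) ul.
apply: (nondecreasing_cvgn_le (u_ := fun M => \sum_(t < M) u t)).
  by apply/nondecreasing_seqP => M; rewrite big_ord_recr /= lerDl.
by apply/cvg_ex; exists l.
Qed.

Lemma distr_partial N : \sum_(t < N) D t <= 1.
Proof. by apply: partial_sum_le => //; case: Ddistr. Qed.

Lemma mean_partial N : \sum_(t < N) t%:R * D t <= d.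
Proof. by apply: (@partial_sum_le (fun t => t%:R * D t)) => // t; rewrite mulr_ge0. Qed.

Lemma mean_ge0 : 0 <= d.
Proof. by have := mean_partial 0; rewrite big_ord0. Qed.

Lemma plogp_le (p m : R) : 0 <= p -> 0 < m -> plogp p m <= p * (p / m - 1).
Proof.
move=> p0 m0; rewrite /plogp; case: eqVneq => [->|pn]; first by rewrite mul0r.
have pm : 0 < p / m by rewrite divr_gt0 // lt_def pn.
rewrite ler_wpM2l // -[X in ln X](subrK 1) addrC le_ln1Dx //; lra.
Qed.

(** Relative entropy is at most chi-square, by [ln x <= x - 1]. *)
Lemma mi_term_le (p q : R) : 0 <= p -> 0 <= q -> mi_term p q <= phi 0 p q.
Proof.
move=> p0 q0; have [e|s] := eqVneq (p + q) 0.
  have [-> ->] : p = 0 /\ q = 0 by lra.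
  by rewrite /mi_term /plogp eqxx addr0 mulr0 phi_ge0.
have m0 : 0 < (p + q) / 2 by rewrite divr_gt0 // lt_def s addr_ge0.
apply: (@le_trans _ _ (2^-1 * (p * (p / ((p + q) / 2) - 1) + q * (q / ((p + q) / 2) - 1)))).
  by rewrite /mi_term ler_wpM2l // lerD // plogp_le.
by rewrite /phi mul0r addr0 le_eqVlt; apply/orP; left; apply/eqP; field.
Qed.

Lemma mutual_info_le k (B : R) : (forall A, uniq A -> info 0 k A <= B) ->
  (0 <= mutual_info r lam D k <= B%:E)%E.
Proof.
move=> hB; apply/andP; split.
  (* The infinite sum is a supremum of finite sums, and the empty one gives the lower bound. *)
  apply: ereal_sup_ubound; exists set0; first exact: fsets_set0.
  by rewrite fsbig_set0.
apply: ge_ereal_sup => _ [X [finX _] <-].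
rewrite fsbig_finite // sumEFin lee_fin.
apply: le_trans (hB _ (finmap.fset_uniq _)).
by apply: ler_sum => o _; apply: mi_term_le; apply: lik_ge0.
Qed.

Lemma info_mono c k A : 0 <= c -> info 0 k A <= info c k A.
Proof.
move=> c0; apply: ler_sum => o _; rewrite (phi_quart c) lerDl mulr_ge0 //.
rewrite /quart expr4 divr_ge0 ?sqr_ge0 // exprn_ge0 // divr_ge0 // addr_ge0 //; exact: lik_ge0.
Qed.

Lemma impossible_of_decay c (u : nat -> R) : 0 <= c -> u @ \oo --> 0 ->
  (forall k A, uniq A -> info c k A <= u k) -> reconstruction_impossible r lam D.
Proof.
move=> c0 u0 h; rewrite /reconstruction_impossible.
apply: (@squeeze_cvge _ _ _ _ (cst 0%E) _ (fun k => (u k)%:E)).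
- apply: nearW => k; apply: mutual_info_le => A uA.
  exact: le_trans (info_mono _ _ c0) (h _ _ uA).
- exact: cvg_cst.
- by apply: cvg_EFin => //; apply: nearW.
Qed.

Let step c k A := @info_step R r lam D lam01 D0 distr_partial d mean_partial c k A.

Lemma impossible_geometric (rho : R) : 0 <= rho < 1 ->
  (forall k A, uniq A -> perm_eq (map flip A) A -> d * edge_info 0 k A <= rho * info 0 k A) ->
  reconstruction_impossible r lam D.
Proof.
move=> hr h; apply: (@impossible_of_decay 0 (fun k => rho ^+ k)) => //.
  by apply: cvg_expr; rewrite ger0_norm; lra.
elim=> [|k IH] A uA; first by rewrite expr0 -[leRHS]addr0; apply: info_ub => //; apply: distr_partial.
have [|A' [uA' pA'] le] := step k (c := 0) _ uA; first by rewrite lexx /=; lra.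
apply: le_trans le (le_trans (h _ _ uA' pA') _).
by rewrite exprS ler_wpM2l ?IH //; lra.
Qed.

(** The map [x |-> x - kap * x ^+ 2] preserves the invariant [kap * x <= 1 / (k + 2)], whence decay
    like [1 / k]. *)
Lemma impossible_quadratic c (kap : R) : 0 <= c <= 3^-1 -> 0 < kap <= 3 / 8 ->
  (forall k A, uniq A -> perm_eq (map flip A) A ->
     d * edge_info c k A <= info c k A - kap * info c k A ^+ 2) ->
  reconstruction_impossible r lam D.
Proof.
move=> hc hk h; have c0 : 0 <= c by lra.
have k0 : 0 < kap by lra.
apply: (@impossible_of_decay c (fun k => kap^-1 * harmonic k)) => //.
  by rewrite -[X in _ --> X](mulr0 kap^-1); apply: cvgMr; apply: cvg_harmonic.
suff key k A : uniq A -> kap * info c k A <= k.+2%:R^-1.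
  move=> k A /(key k) H; rewrite mulrC ler_pdivlMr // mulrC; apply: le_trans H _.
  by rewrite /= lef_pV2 ?posrE ?ltr0n // ler_nat.
elim: k A => [|k IH] A uA.
  have := @info_ub R r lam D lam01 D0 distr_partial c 0 A c0 uA.
  (* The invariant at [k = 0]: the information is at most [1 + c <= 4 / 3], and [kap <= 3 / 8]. *)
  have kI : kap * info c 0 A <= 3 / 8 * (4 / 3) -> kap * info c 0 A <= 2^-1 by lra.
  by move=> H; apply: kI; apply: ler_pM; rewrite ?info_ge0 //; lra.
have [A' [uA' pA'] le] := step k hc uA.
have := le_trans le (h _ _ uA' pA'); have := IH _ uA'.
set X := info c k A'; set Y := info c k.+1 A.
have X0 : 0 <= X by apply: info_ge0.
set m : R := k.+2%:R => IHX YX.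
have m2 : 2 <= m by rewrite /m (ler_nat R 2).
have -> : k.+3%:R = m + 1 :> R by rewrite /m -natr1.
clearbody m; have mV : m * m^-1 = 1 by rewrite mulfV //; lra.
have v0 : 0 <= m^-1 by rewrite invr_ge0; lra.
have v2 : m^-1 <= 2^-1 by rewrite lef_pV2 ?posrE //; lra.
have a0 : 0 <= kap * X by rewrite mulr_ge0 // ltW.
have h1 : kap * Y <= kap * X - (kap * X) ^+ 2 by nra.
(* [x - x ^+ 2] is increasing on [[0, 1/2]], which contains both values. *)
have h2 : kap * X - (kap * X) ^+ 2 <= m^-1 - m^-1 ^+ 2.
  rewrite -subr_ge0.
  have -> : m^-1 - m^-1 ^+ 2 - (kap * X - (kap * X) ^+ 2)
    = (m^-1 - kap * X) * (1 - m^-1 - kap * X) by ring.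
  by apply: mulr_ge0; lra.
apply: (le_trans h1 (le_trans h2 _)).
rewrite -[leRHS]mul1r ler_pdivlMr; last by lra.
have -> : (m^-1 - m^-1 ^+ 2) * (m + 1) = m * m^-1 + m^-1 - m * m^-1 * m^-1 - m^-1 ^+ 2 by ring.
by rewrite mV mul1r; have := sqr_ge0 m^-1; lra.
Qed.

(* The bound is [0 <= 0] when [lam = 0], whence the weaker requirement on [kap] there. *)
Lemma impossible_critical c (kap : R) : 0 <= c <= 3^-1 -> 0 <= kap <= 3 / 8 ->
  (lam != 0 -> 0 < kap) -> n%:R * d * lam ^+ 2 <= 1 ->
  (forall k A, uniq A -> perm_eq (map flip A) A ->
     edge_info c k A <= n%:R * lam ^+ 2 * (info c k A - kap * info c k A ^+ 2)) ->
  reconstruction_impossible r lam D.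
Proof.
move=> hc hk hk0 ks h; have c0 : 0 <= c by lra.
have gain K k A : 0 <= K <= 3 / 8 -> uniq A -> 0 <= info c k A - K * info c k A ^+ 2.
  move=> hK uA; have I0 := @info_ge0 R r lam D lam01 D0 c k A c0.
  have I1 := @info_ub R r lam D lam01 D0 distr_partial c k A c0 uA.
  rewrite -[X in X - _]mul1r expr2 mulrA -mulrBl mulr_ge0 // subr_ge0.
  have : K * info c k A <= 3 / 8 * (4 / 3) by apply: ler_pM => //; lra.
  lra.
have [l0|ln0] := eqVneq lam 0.
  apply: (@impossible_quadratic c (3 / 8)) => //; first by lra.
  move=> k A uA pA; apply: (@le_trans _ _ 0); last by apply: gain => //; lra.
  rewrite mulr_ge0_le0 // ?mean_ge0 //; apply: le_trans (h k A uA pA) _.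
  by rewrite l0 expr0n /= mulr0 mul0r.
apply: (@impossible_quadratic c kap) => //; first by rewrite hk0 //; lra.
move=> k A uA pA; apply: le_trans (ler_wpM2l mean_ge0 (h k A uA pA)) _.
set G := _ - _; have -> : d * (n%:R * lam ^+ 2 * G) = n%:R * d * lam ^+ 2 * G by ring.
by rewrite ler_piMl //; apply: gain.
Qed.

Section EdgeBounds.
Variables (k : nat) (A : seq tree).
Hypotheses (uA : uniq A) (pA : perm_eq (map flip A) A).

Let lik0 s o : 0 <= L k s o := @lik_ge0 R r lam D lam01 D0 k s o.
Let symA (F : R -> R -> R) := @sum_flip R r lam D k A F pA.
Let massA := half_mass (@lik_mass R r lam D lam01 D0 distr_partial k true A uA)
  (@lik_mass R r lam D lam01 D0 distr_partial k false A uA).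

Lemma info01 : 0 <= info 0 k A <= 1.
Proof. exact: (X01 (lik0 true) (lik0 false) massA). Qed.

Lemma edge_info_le_binavg : edge_info 0 k A <= binavg (info 0 k A) n (reveal lam).
Proof. exact: (edge_sum0 (lik0 true) (lik0 false) symA massA lam01 n). Qed.

Lemma edge_info_le_quad (eta : R) :
  (forall j, (j <= n)%N -> reveal lam j <= lam ^+ 2 * (j%:R - eta * (j%:R * (j%:R - 1)))) ->
  edge_info 0 k A <= n%:R * lam ^+ 2 * (info 0 k A - eta * (n%:R - 1) * info 0 k A ^+ 2).
Proof. by move=> h; apply: le_trans edge_info_le_binavg (binavg_reveal_le info01 h). Qed.

(** The loss [lam / 10] on the quartic moment [Q] becomes a quadratic gain because [Q] dominates the
    squared information. *)
Lemma edge_info_le_three : n = 3%N -> lam <= 8^-1 ->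
  edge_info 3^-1 k A <= 3 * lam ^+ 2 * (info 3^-1 k A - 9 / 160 * lam * info 3^-1 k A ^+ 2).
Proof.
move=> n3 l8; have hl : 0 <= lam <= 8^-1 by move: lam01; lra.
have h := edge_sum3 (lik0 true) (lik0 false) symA massA hl.
rewrite /edge_info n3; apply: le_trans h _.
apply: ler_wpM2l; first by rewrite mulr_ge0 ?sqr_ge0.
pose Q := \sum_(o <- A) quart (L k true o) (L k false o).
have dec c : \sum_(o <- A) phi c (L k true o) (L k false o) = info 0 k A + c * Q.
  by under eq_bigr => o _ do rewrite phi_quart; rewrite big_split /= -mulr_sumr.
have hQ : info 0 k A ^+ 2 <= Q := sum_quart_ge (lik0 true) (lik0 false) massA.
have QI : Q <= info 0 k A.
  by apply: ler_sum => o _; apply: quart_le; apply: lik0.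
have /andP[I0 _] := info01.
have infoE : info 3^-1 k A = info 0 k A + 3^-1 * Q := dec _.
rewrite dec infoE.
have Q0 : 0 <= Q := le_trans (sqr_ge0 _) hQ.
move: (info 0 k A) Q {dec infoE} hQ QI I0 Q0 => I Q hQ QI I0 Q0.
(* From [Q <= I] and [I ^+ 2 <= Q]; then [9 / 160 * (16 / 9)] is exactly [1 / 10]. *)
have sq : (I + 3^-1 * Q) ^+ 2 <= 16 / 9 * Q by nra.
have lsq : lam * (I + 3^-1 * Q) ^+ 2 <= lam * (16 / 9 * Q) by rewrite ler_wpM2l //; lra.
lra.
Qed.

End EdgeBounds.

(** The term [j = 0] vanishes and every other one has a factor [X], which shifts the exponent to
    that of [fr]. *)
Lemma binavg_fr (X : R) : (0 < n)%N -> binavg X n (reveal lam) = n%:R * X * fr r lam X.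
Proof.
move=> n0; rewrite /binavg /fr big_ord_recl /= mulr0 add0r.
have -> : \sum_(1 <= i < r) 'C(n, i)%:R * (1 - X) ^+ (n - i) * X ^+ i.-1 *
    (lam ^+ 2 / (lam + (1 - lam) * ((2 : R) ^+ i.-1)^-1))
  = \sum_(i < n) 'C(n, i.+1)%:R * (1 - X) ^+ (n - i.+1) * X ^+ i *
    (lam ^+ 2 / (lam + (1 - lam) / 2 ^+ i)).
  by rewrite big_add1 big_mkord.
rewrite mulrACA mulfV ?pnatr_eq0 -?lt0n // mul1r mulr_sumr.
apply: eq_bigr => i _; rewrite /bump /= add1n exprS.
by move: ('C(n, i.+1)%:R : R) ((1 - X) ^+ (n - i.+1)) (X ^+ i) (_ / _) => u v z w; ring.
Qed.

Lemma fr_ge0 (e : R) : 0 < e <= 1 -> 0 <= fr r lam e.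
Proof.
move=> he; rewrite /fr mulr_ge0 ?invr_ge0 ?ler0n // sumr_ge0 // => i _.
rewrite mulr_ge0 //; first by rewrite !mulr_ge0 ?ler0n // exprn_ge0 //; lra.
exact: (@reveal_ge0 R lam i.-1.+1 lam01).
Qed.

Lemma fr_le_sup (e : R) : 0 < e <= 1 ->
  fr r lam e <= sup [set fr r lam x | x in [set x : R | 0 < x <= 1]].
Proof.
move=> he; apply: ub_le_sup; last by exists e.
(* The supremum needs a bounded set; replacing all powers of [x] and [1 - x] by 1 gives a bound. *)
exists (n%:R^-1 * \sum_(1 <= i < r) 'C(n, i)%:R * reveal lam i.-1.+1) => _ [x /= hx <-].
rewrite /fr ler_wpM2l ?invr_ge0 ?ler0n //; apply: ler_sum => i _.
apply: ler_wpM2r; first exact: (@reveal_ge0 R lam i.-1.+1 lam01).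
rewrite -mulrA ler_piMr ?ler0n // mulr_ile1 ?exprn_ge0 ?exprn_ile1 //; lra.
Qed.

Lemma impossible_small_degree : (0 < n)%N ->
  n%:R * d * sup [set fr r lam e | e in [set e : R | 0 < e <= 1]] < 1 ->
  reconstruction_impossible r lam D.
Proof.
move=> n0; set s := sup _ => hs.
have s0 : 0 <= s.
  by apply: le_trans (fr_le_sup (e := 1) _); [apply: fr_ge0|]; rewrite ltr01 lexx.
apply: (@impossible_geometric (n%:R * d * s)).
  by rewrite hs !mulr_ge0 ?mean_ge0.
move=> k A uA pA; apply: le_trans (ler_wpM2l mean_ge0 (edge_info_le_binavg k uA pA)) _.
have /andP[I0 I1] := info01 k uA; rewrite binavg_fr //.
have -> : d * (n%:R * info 0 k A * fr r lam (info 0 k A)) = n%:R * d * info 0 k A * fr r lam (info 0 k A) by ring.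
(* Information [0] lies outside the range of the supremum and is treated apart. *)
rewrite [leRHS]mulrAC; have [->|Ip] := eqVneq (info 0 k A) 0; first by rewrite !(mulr0, mul0r).
by apply: ler_wpM2l; [rewrite !mulr_ge0 ?mean_ge0|apply: fr_le_sup; rewrite lt_def Ip I0 I1].
Qed.

Lemma impossible_three : r = 3%N -> n%:R * d * lam ^+ 2 <= 1 -> reconstruction_impossible r lam D.
Proof.
have l01 := lam01; have c01 : ((0 : R) <= 0) && ((0 : R) <= 3^-1) by rewrite lexx invr_ge0 ler0n.
have hk : 0 <= 3 / 8 * lam <= 3 / 8 by lra.
have kp : lam != 0 -> 0 < 3 / 8 * lam by move=> ln0; rewrite mulr_gt0 // lt_def ln0; lra.
move=> r3 ks; apply: (impossible_critical c01 hk kp ks) => k A uA pA.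
have := @edge_info_le_quad k A uA pA (3 / 8 * lam); rewrite r3 /= => H.
apply: le_trans (H _) _; first by move=> j; apply: reveal_two.
by rewrite le_eqVlt; apply/orP; left; apply/eqP; ring.
Qed.

(** The comparison with revealed children yields no gain for [lam <= 1 / 9], so small [lam] uses the
    functional with [c = 3^-1]. *)
Lemma impossible_four : r = 4%N -> n%:R * d * lam ^+ 2 <= 1 -> reconstruction_impossible r lam D.
Proof.
have l01 := lam01; have [l8|l8] := leP lam 8^-1.
  have c01 : ((0 : R) <= 3^-1) && ((3^-1 : R) <= 3^-1) by lra.
  have hk : 0 <= 9 / 160 * lam <= 3 / 8 by lra.
  have kp : lam != 0 -> 0 < 9 / 160 * lam by move=> ln0; rewrite mulr_gt0 // lt_def ln0; lra.
  move=> r4 ks; apply: (impossible_critical c01 hk kp ks) => k A uA pA.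
  by have := @edge_info_le_three k A uA pA; rewrite r4 /=; apply.
have c01 : ((0 : R) <= 0) && ((0 : R) <= 3^-1) by rewrite lexx invr_ge0 ler0n.
(* [50^-1] is [eta * (n - 1)] for [eta = 100^-1] and [n = 3]. *)
have hk : ((0 : R) <= 50^-1) && ((50^-1 : R) <= 3 / 8) by lra.
have hl : 8^-1 <= lam <= 1 by lra.
move=> r4 ks; apply: (impossible_critical c01 hk _ ks) => [_|k A uA pA]; first by rewrite invr_gt0.
have := @edge_info_le_quad k A uA pA 100^-1; rewrite r4 /= => H.
apply: le_trans (H _) _; first by move=> j; apply: reveal_three.
by rewrite le_eqVlt; apply/orP; left; apply/eqP; field.
Qed.

Lemma impossible_large_lam : (3 <= r)%N -> 5^-1 <= lam -> n%:R * d * lam ^+ 2 <= 1 ->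
  reconstruction_impossible r lam D.
Proof.
move=> r3 hl ks; have n2 : (2 <= n)%N by case: (r) r3 => [|[|[|]]].
have l01 : 5^-1 <= lam <= 1 by rewrite hl; case/andP: lam01.
have n2R : 2 <= n%:R :> R by rewrite (ler_nat R 2).
have c01 : ((0 : R) <= 0) && ((0 : R) <= 3^-1) by rewrite lexx invr_ge0 ler0n.
have n5 : 0 < 5 * n%:R :> R by lra.
(* This gain is [n - 1] times the coefficient of [reveal_many]. *)
have kp : 0 < (5 * n%:R)^-1 :> R by rewrite invr_gt0.
have hk : ((0 : R) <= (5 * n%:R)^-1) && ((5 * n%:R)^-1 <= (3 / 8 : R)).
  by rewrite (ltW kp) -div1r ler_pdivrMr //=; lra.
apply: (impossible_critical c01 hk (fun=> kp) ks) => k A uA pA.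
have := @edge_info_le_quad k A uA pA (5 * n%:R * (n%:R - 1))^-1.
move=> H; apply: le_trans (H _) _; first by move=> j; apply: reveal_many.
have -> : (5 * n%:R * (n%:R - 1))^-1 * (n%:R - 1) = (5 * n%:R)^-1 :> R.
  by field; apply/andP; split; rewrite gt_eqF; lra.
by [].
Qed.

End Decay.

Theorem theorem2 (R : realType) (r : nat) (lam : R) (D : nat -> R) (d : R) :
  (2 <= r)%N -> 0 <= lam <= 1 -> is_distr D -> has_mean D d ->
  [/\ ((r == 3%N) || (r == 4%N) -> (r.-1)%:R * d * lam ^+ 2 <= 1 ->
         reconstruction_impossible r lam D),
      ((5 <= r)%N ->
         (r.-1)%:R * d * sup [set fr r lam e | e in [set e : R | 0 < e <= 1]] < 1 ->
         reconstruction_impossible r lam D)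
    & ((5 <= r)%N -> 5^-1 <= lam -> (r.-1)%:R * d * lam ^+ 2 <= 1 ->
         reconstruction_impossible r lam D)].
Proof.
move=> _ hl hD hd; split=> [/orP[] /eqP hr|hr|hr].
- exact: (impossible_three hl hD hd).
- exact: (impossible_four hl hD hd).
- by apply: (impossible_small_degree hl hD hd); case: (r) hr => [|[|]].
- by apply: (impossible_large_lam hl hD hd); apply: leq_trans hr.
Qed.
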